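(* Assume that there are constants $\chi,\sigma>0$ such that for every $f\in F$, $$(P f^4)^{1/4}\leq \chi (Pf^2)^{1/2}\quad\text{and}\quad P\left[(Y-f^* )^2(f-f^* )^2\right]\leq \sigma^2 P(f-f^* )^2 .$$ Assume that the integer $V$ satisfies $3|\mathcal{O}|\leq V\leq N/8$. Then, with probability larger than $1-|\mathcal{M}|^2e^{-V/48}$, the estimator $\hat f_{\hat m}$, where $\hat m\in\operatorname{argmin}_{m\in\mathcal{M}}\max_{m'\in\mathcal{M}}\mathcal{T}(m,m')$ is selected by the minmax-MOM procedure, satisfies, for all $\varepsilon>0$, $$(1-a_{\varepsilon,V})\,\ell(\hat f_{\hat m})\leq (1+3a_{\varepsilon,V})\min_{m\in\mathcal{M}}\ell(\hat f_m)+2b_{\varepsilon,V},$$ where $a_{\varepsilon,V}:=8\chi^2\sqrt{2V/N}+2\sqrt{2}\,\varepsilon$ and $b_{\varepsilon,V}:=\dfrac{64V\sigma^2}{N\varepsilon}$.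
   Context: Notation: $[k]=\{1,\dots,k\}$. Let $\mathbb{X}$ be a measurable space, $P$ a probability distribution on $\mathbb{X}\times\mathbb{R}$, $(X,Y)\sim P$ with $\mathbb{E}[Y^2]<+\infty$, and $P_X$ the marginal distribution of $X$. $L^2(P_X)$ is the Hilbert space of measurable $f:\mathbb{X}\to\mathbb{R}$ with $\mathbb{E}[f(X)^2]<\infty$, with norm $\|f\|=\sqrt{\mathbb{E}[f(X)^2]}$. For a probability measure $Q$ and $g\in L^1(Q)$, $Q[g]=\mathbb{E}_{Z\sim Q}[g(Z)]$ (so, e.g., $Pf^2=\mathbb{E}[f(X)^2]$ and $P[(Y-f^* )^2(f-f^* )^2]=\mathbb{E}[(Y-f^*(X))^2(f(X)-f^*(X))^2]$). Let $F$ be a linear subspace of $L^2(P_X)$; elements of $F$ are called estimators. For $f\in F$, $\gamma(f)(x,y)=(y-f(x))^2$, $R(f)=P[\gamma(f)]$, $f^*=\operatorname{argmin}_{f\in F}R(f)$ (the oracle, taken to exist), and the excess risk is $\ell(f)=R(f)-R(f^* )=\|f-f^*\|^2$. A learning algorithm is a measurable map $G:\bigcup_{n\ge1}(\mathbb{X}\times\mathbb{R})^n\to F$. Data: $N\geq1$ and a dataset $(X_i,Y_i)_{i\in[N]}$, with $[N]=\mathcal{O}\sqcup\mathcal{I}$ (a partition unknown to the learner). The informative data $(X_i,Y_i)_{i\in\mathcal{I}}$ are i.i.d. with distribution $P$; no assumption is made on the outliers $(X_i,Y_i)_{i\in\mathcal{O}}$. A subsample is a nonempty $B\subset[N]$,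 and $P_B[g]=\frac1{|B|}\sum_{i\in B}g(X_i,Y_i)$. Minmax-MOM selection: $\mathcal{M}$ is a finite index set; for each $m\in\mathcal{M}$ there are a learning algorithm $G_m$ and a subsample $B_m\subset[N]$ of cardinality less than $N/4$ with $\hat f_m=G_m((X_i,Y_i)_{i\in B_m})$. $V$ is an integer with $1\leq V\leq N/8$. For each $(m,m')\in\mathcal{M}^2$, $(T_v^{(m,m')})_{v\in[V]}$ is a partition into $V$ blocks of a subset of $[N]\setminus(B_m\cup B_{m'})$ such that $|T_v^{(m,m')}|\geq N/(4V)$ for all $v\in[V]$. Define $$\mathcal{T}(m,m')=\operatorname{med}_{v\in[V]}\left\{P_{T_v^{(m,m')}}[\gamma(\hat f_m)-\gamma(\hat f_{m'})]\right\},$$ where $\operatorname{med}$ is the median.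
   Formalization: The formal theorem also assumes that, for all m, m', the data indexed by B_m ∪ B_m' (outliers included) are independent of the informative data in the test blocks T^{(m,m')}; with fully arbitrary outliers in the training subsamples, the claim fails. *)

(* Defs.v *)
From HB Require Import structures.
From mathcomp Require Import all_boot all_order all_algebra.
From mathcomp Require Import all_classical all_reals all_analysis.

Set Implicit Arguments.
Unset Strict Implicit.
Unset Printing Implicit Defensive.

Import Order.TTheory GRing.Theory Num.Theory.

Local Open Scope classical_set_scope.
Local Open Scope ring_scope.

(** * Medians and finite extrema *)

(* For even [V] medians are not unique; every convention (lower, upper,
   midpoint) yields an [x] with this property. *)
Definition is_median (R : realType) (V : nat) (u : 'I_V -> R) (x : R) : Prop :=
  (V <= 2 * #|[pred v | (u v <= x)%R]|)%N /\
  (V <= 2 * #|[pred v | (x <= u v)%R]|)%N.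

(* [i0] only witnesses that the index type is inhabited: the value is the
   extremum of [u] over the whole of [I], whatever [i0]. *)
Definition finmax (R : realType) (I : finType) (i0 : I) (u : I -> R) : R :=
  \big[Num.max/u i0]_(i : I) u i.

Definition finmin (R : realType) (I : finType) (i0 : I) (u : I -> R) : R :=
  \big[Num.min/u i0]_(i : I) u i.

Definition is_argmin (R : realType) (I : finType) (u : I -> R) (i : I) : Prop :=
  forall j, u i <= u j.

(** * Independence *)

Section independence.
Context (R : realType) (dO d : measure_display)
  (Omega : measurableType dO) (Pr : probability Omega R)
  (Z : measurableType d) (N : nat) (D : 'I_N -> Omega -> Z).

Definition mutually_independent (S : {set 'I_N}) : Prop :=
  forall J : {set 'I_N}, J \subset S ->
  forall A : 'I_N -> set Z, (forall i, measurable (A i)) ->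
    Pr (\bigcap_(i in [set` J]) (D i @^-1` A i)) =
    (\prod_(i in J) Pr (D i @^-1` A i))%E.

Definition sigma_of (S : {set 'I_N}) : set (set Omega) :=
  <<s [set E | exists i A, [/\ i \in S, measurable A & E = D i @^-1` A] ] >>.

Definition independent_families (S S' : {set 'I_N}) : Prop :=
  forall E E', sigma_of S E -> sigma_of S' E' ->
    Pr (E `&` E') = (Pr E * Pr E')%E.

Definition iid_with_law (P : probability Z R) (S : {set 'I_N}) : Prop :=
  (forall i A, i \in S -> measurable A -> Pr (D i @^-1` A) = P A) /\
  mutually_independent S.

End independence.

(** * Least-squares regression *)

Section regression.
Context (R : realType) (d : measure_display) (X : measurableType d).

Local Notation Z := (X * R)%type.

(* Estimators are genuine functions rather than almost-everywhere classes,
   since they are evaluated at the points of the dataset. *)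
Definition L2_subspace (P : probability Z R) (F : set (X -> R)) : Prop :=
  [/\ forall f, F f ->
        measurable_fun setT f /\ ('E_P[fun z => (f z.1 ^+ 2)%R] < +oo)%E,
      F (fun=> 0) &
      forall (a : R) f g, F f -> F g -> F (fun x => a * f x + g x)].

Definition loss (f : X -> R) (z : Z) : R := (z.2 - f z.1) ^+ 2.

Definition risk (P : probability Z R) (f : X -> R) : \bar R := 'E_P[loss f].

Definition is_oracle (P : probability Z R) (F : set (X -> R)) (fstar : X -> R)
    : Prop :=
  F fstar /\ forall f, F f -> (risk P fstar <= risk P f)%E.

(* Both risks are finite as soon as [E[Y^2]], [E[f(X)^2]] and [E[fstar(X)^2]]
   are. *)
Definition excess_risk (P : probability Z R) (fstar f : X -> R) : R :=
  fine (risk P f) - fine (risk P fstar).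

(* Measurability of a function-valued map is joint measurability in the dataset
   and the evaluation point, so that evaluating the estimator at a random point
   gives a random variable. *)
Definition learning_algorithm (F : set (X -> R))
    (G : forall n, n.-tuple Z -> X -> R) : Prop :=
  forall n, (0 < n)%N ->
    (forall s, F (G n s)) /\
    measurable_fun [set: n.-tuple Z * X] (fun sx => G n sx.1 sx.2).

End regression.

(** * Minmax-MOM selection *)

Section minmax_MOM.
Context (R : realType) (d : measure_display) (X : measurableType d)
  (Omega : Type) (N : nat).

Local Notation Z := (X * R)%type.

Definition empirical_mean (D : 'I_N -> Omega -> Z) (S : {set 'I_N})
    (g : Z -> R) (w : Omega) : R :=
  #|S|%:R^-1 * \sum_(i in S) g (D i w).

Definition subdata (D : 'I_N -> Omega -> Z) (S : {set 'I_N}) (w : Omega)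
    : #|S|.-tuple Z :=
  [tuple of [seq D i w | i <- enum_tuple S]].

Definition estimator (D : 'I_N -> Omega -> Z) (S : {set 'I_N})
    (G : forall n, n.-tuple Z -> X -> R) (w : Omega) : X -> R :=
  G #|S| (subdata D S w).

Definition test_blocks (V : nat) (S : {set 'I_N}) (T : 'I_V -> {set 'I_N})
    : Prop :=
  [/\ forall v, T v \subset ~: S,
      forall v v', v != v' -> (T v :&: T v')%SET = finset.set0 &
      forall v, N%:R / (4 * V%:R) <= #|T v|%:R :> R].

End minmax_MOM.

Arguments test_blocks R {N V}.

Definition a_const (R : realType) (chi : R) (N V : nat) (eps : R) : R :=
  8 * chi ^+ 2 * Num.sqrt (2 * V%:R / N%:R) + 2 * Num.sqrt 2 * eps.

Definition b_const (R : realType) (sigma : R) (N V : nat) (eps : R) : R :=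
  64 * V%:R * sigma ^+ 2 / (N%:R * eps).

(* Main.v *)
Require Import Defs.
From HB Require Import structures.
From mathcomp Require Import all_boot all_order all_algebra.
From mathcomp Require Import all_classical all_reals all_analysis.
From mathcomp Require Import measurable_realfun.
From mathcomp Require Import ring lra.

Set Implicit Arguments.
Unset Strict Implicit.
Unset Printing Implicit Defensive.

Import Order.TTheory GRing.Theory Num.Theory.

Local Open Scope classical_set_scope.
Local Open Scope ring_scope.

(** Fix two indices [m], [m'] and write [f], [g] for the two trained
    estimators, [l], [l'] for their excess risks.  The increment
    [h = loss f - loss g] has mean [l - l'] under [P], and its second moment is
    controlled by the excess risks alone: with [u = f - fstar], [v = g - fstar]
    and [xi = Y - fstar], one has [h = u^2 - v^2 - 2 xi u + 2 xi v], so that the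
    two moment hypotheses bound [E h^2] by
    [moment_bound = 4 chi^4 (l^2 + l'^2) + 16 sigma^2 (l + l')]
    ([loss_diff_second_moment]).  That [E u^2] is at most the excess risk
    follows from the optimality of [fstar] along the segments of the linear
    space [F] ([sqdist_le_excess_risk]).

    A block of size at least [N / (4 V)] without outliers therefore has, by
    Chebyshev's inequality, an empirical mean of [h] within
    [t = sqrt (32 V / N * moment_bound)] of [l - l'], except with probability
    at most [1/8] ([block_mean_deviation]).  Blocks are disjoint, so these
    deviations are independent ([independent_blocks]).  The outliers spoil at
    most [V / 3] blocks, hence at least [2 V / 3] blocks are clean, and the
    median can leave [l - l' +- t] only if at least a quarter of the clean
    blocks deviate.  As the expected fraction is at most [1/8], the exponential
    moment bound at [lambda = 1/2] gives probability at most [exp (- V / 48)]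
    ([chernoff_count], [chernoff_majority]).

    The estimators are random, so all of this is done conditionally on the
    training data.  Conditioning is replaced by a product measure: the
    identity of the sample space, read once with the sigma-algebra of the
    training data and once with that of the informative test data, has a product
    law, and a set all of whose sections have probability at most [p] has
    probability at most [p] ([decoupling]).

    A union bound over the pairs gives an event on which every test statistic
    is within [t] of its target.  The threshold [t] does not involve [eps];
    it is at most [a (l + l') + b] for every [eps > 0], by the inequality between
    arithmetic and geometric means ([threshold_le]).  On that event the oracle
    inequality is a deterministic fact about minmax selection
    ([minmax_selection]), trivial when [a > 1]: otherwise, if [m0] has the
    smallest excess risk, then [mhat] loses at least
    [(1 - a) l_mhat - (1 + a) l_m0 - b] against [m0], while [m0] loses at most [2 a l_m0 + b] against anybody. *)

(** * Independence of families of coordinates *)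

(** The events [E] satisfying the product rule with [E'] form a Dynkin system,
    so the rule extends from a pi-system to the sigma-algebra it generates. *)
Lemma pi_lambda_indep (R : realType) (dO : measure_display)
    (Omega : measurableType dO) (Pr : probability Omega R)
    (C : set (set Omega)) (E' : set Omega) :
  setI_closed C -> C `<=` measurable -> measurable E' ->
  (forall E, C E -> Pr (E `&` E') = (Pr E * Pr E')%E) ->
  forall E, <<s C >> E -> Pr (E `&` E') = (Pr E * Pr E')%E.
Proof.
move=> CI Cm mE' H E; rewrite -(setI_closed_g_dynkin_g_sigma_algebra CI) => CE.
suff [] : measurable E /\ Pr (E `&` E') = (Pr E * Pr E')%E by [].
move: E CE; apply: smallest_sub => [|E CE]; last by split; [exact: Cm|exact: H].
have fE' := @fin_num_measure _ _ _ Pr _ mE'.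
split.
- by split=> //; rewrite setTI probability_setT mul1e.
- move=> A [mA indA]; split; first exact: measurableC.
  rewrite [~` A `&` E']setIC -setDE measureD ?fin_num_fun_lty//; last first.
    by rewrite ltey_eq fE'.
  rewrite (setIC E') [X in (_ - X)%E]indA probability_setC// muleBl ?mul1e//.
- move=> F tF HF; have mF n : measurable (F n) by case: (HF n).
  split; first exact: bigcupT_measurable.
  rewrite setI_bigcupl measure_bigcup//=; last 2 first.
    by move=> i _; exact: measurableI.
    by apply: trivIset_setIr.
  rewrite measure_bigcup//= -(fineK fE') muleC -nneseriesZl//.
  by apply: eq_eseriesr => i _; rewrite fineK// muleC; case: (HF i).
Qed.

Section independence.
Context (R : realType) (dO d : measure_display)
  (Omega : measurableType dO) (Pr : probability Omega R)
  (Z : measurableType d) (N : nat) (D : 'I_N -> Omega -> Z).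
Hypothesis hD : forall i, measurable_fun setT (D i).

Definition coordinate_events (S : {set 'I_N}) : set (set Omega) :=
  [set E | exists i A, [/\ i \in S, measurable A & E = D i @^-1` A] ].

(** The generators of [sigma_of D S] are not stable under intersection; finite
    cylinders are, and they generate the same sigma-algebra. *)
Definition cylinders (S : {set 'I_N}) : set (set Omega) :=
  [set E | exists2 A : 'I_N -> set Z, (forall i, measurable (A i)) &
     E = \bigcap_(i in [set` S]) (D i @^-1` A i)].

Lemma measurable_preimage i A : measurable A -> measurable (D i @^-1` A).
Proof. by move=> mA; rewrite -[_ @^-1` _]setTI; exact: hD. Qed.

Lemma cylinders_setI S : setI_closed (cylinders S).
Proof.
move=> _ _ [A mA ->] [B mB ->]; exists (fun i => A i `&` B i).
  by move=> i; exact: measurableI.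
by rewrite -bigcapI; apply: eq_bigcapr => i _; rewrite preimage_setI.
Qed.

Lemma cylinders_measurable S : cylinders S `<=` measurable.
Proof.
move=> _ [A mA ->]; apply: fin_bigcap_measurable => [|i _].
  exact: finite_finset.
exact: measurable_preimage.
Qed.

Lemma sigma_of_cylinders S : sigma_of D S `<=` <<s cylinders S >>.
Proof.
apply: smallest_sub; first exact: smallest_sigma_algebra.
move=> _ [i [A [iS mA ->]]]; apply: sub_sigma_algebra.
exists (fun j => if j == i then A else setT).
  by move=> j; case: ifP.
apply/seteqP; split=> [w Aw j _ /=|w /(_ i iS)/=]; last by rewrite eqxx.
by case: eqP => [->|].
Qed.

Lemma sigma_of_measurable S : sigma_of D S `<=` measurable.
Proof.
apply: smallest_sub; first exact: sigma_algebra_measurable.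
by move=> _ [i [A [iS mA ->]]]; exact: measurable_preimage.
Qed.

Lemma sigma_of_sub (S S' : {set 'I_N}) : S \subset S' ->
  sigma_of D S `<=` sigma_of D S'.
Proof.
move=> SS'; apply: smallest_sub; first exact: smallest_sigma_algebra.
move=> _ [i [A [iS mA ->]]]; apply: sub_sigma_algebra.
by exists i, A; split => //; exact: (fintype.subsetP SS').
Qed.

(** The product rule holds between cylinders over [S1] and [S2], since together
    they form a cylinder over the union; the pi-lambda argument is then
    applied in each variable in turn. *)
Lemma independent_disjoint_families (S S1 S2 : {set 'I_N}) :
  mutually_independent Pr D S -> S1 \subset S -> S2 \subset S ->
  (S1 :&: S2)%SET = finset.set0 -> independent_families Pr D S1 S2.
Proof.
move=> indS S1S S2S S12 E1 E2 sE1 sE2.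
have indC E E' : cylinders S1 E -> cylinders S2 E' ->
    Pr (E `&` E') = (Pr E * Pr E')%E.
  move=> [A mA ->] [B mB ->].
  pose AB i := if i \in S1 then A i else B i.
  have mAB i : measurable (AB i) by rewrite /AB; case: ifP.
  have ABA i : i \in S1 -> AB i = A i by rewrite /AB => ->.
  have ABB i : i \in S2 -> AB i = B i.
    move=> iS2; rewrite /AB; case: ifPn => // iS1.
    by have := finset.in_setI i S1 S2; rewrite S12 finset.in_set0 iS1 iS2.
  have -> : \bigcap_(i in [set` S1]) (D i @^-1` A i) =
            \bigcap_(i in [set` S1]) (D i @^-1` AB i).
    by apply: eq_bigcapr => i iS1; rewrite ABA.
  have -> : \bigcap_(i in [set` S2]) (D i @^-1` B i) =
            \bigcap_(i in [set` S2]) (D i @^-1` AB i).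
    by apply: eq_bigcapr => i iS2; rewrite ABB.
  rewrite -bigcap_setU.
  have -> : [set` S1] `|` [set` S2] = [set` (S1 :|: S2)%SET].
    by apply/seteqP; split=> i /=; rewrite inE => /orP.
  rewrite !indS ?finset.subUset ?S1S ?S2S//.
  rewrite -bigU/=; last by rewrite -finset.setI_eq0 S12.
  by apply: eq_bigl => i; rewrite !inE.
have mE1 : measurable E1 := sigma_of_measurable sE1.
apply: (@pi_lambda_indep _ _ _ _ (cylinders S1)) => //.
- exact: cylinders_setI.
- exact: cylinders_measurable.
- exact: sigma_of_measurable sE2.
- move=> E cE; rewrite setIC muleC.
  apply: (@pi_lambda_indep _ _ _ _ (cylinders S2)) => //.
  + exact: cylinders_setI.
  + exact: cylinders_measurable.
  + exact: cylinders_measurable cE.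
  + by move=> E' cE'; rewrite setIC muleC; exact: indC.
  + exact: sigma_of_cylinders sE2.
- exact: sigma_of_cylinders.
Qed.

(** Blocks are added one at a time: the events of the previous blocks lie in the
    sigma-algebra of the union of these blocks, which is disjoint from the new
    one. *)
Lemma independent_blocks (S : {set 'I_N}) (K : finType)
    (T : K -> {set 'I_N}) (A : K -> set Omega) (J : {set K}) :
  mutually_independent Pr D S ->
  (forall v, v \in J -> T v \subset S) ->
  (forall v w, v != w -> (T v :&: T w)%SET = finset.set0) ->
  (forall v, v \in J -> sigma_of D (T v) (A v)) ->
  Pr (\bigcap_(v in [set` J]) A v) = (\prod_(v in J) Pr (A v))%E.
Proof.
move=> indS TS Tdisj sA.
have sub_bigcup (s : seq K) (U : {set 'I_N}) :
    (forall x, x \in s -> T x \subset U) ->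
    (\bigcup_(x <- s) T x)%SET \subset U.
  move=> sU; rewrite big_seq; elim/big_ind: _ => [|A1 A2 A1U A2U|//].
    exact: finset.sub0set.
  by rewrite finset.subUset A1U A2U.
have key (s : seq K) : uniq s -> {subset s <= J} ->
    Pr (\bigcap_(v in [set` s]) A v) = (\prod_(v <- s) Pr (A v))%E /\
    sigma_of D (\bigcup_(v <- s) T v)%SET (\bigcap_(v in [set` s]) A v).
  elim: s => [_ _|v s IH /= /andP[vs us] sJ].
    rewrite !big_nil set_nil bigcap_set0 probability_setT; split=> //.
    by rewrite -setC0; apply: sigma_algebraC; exact: sigma_algebra0.
  have sJ' : {subset s <= J} by move=> x xs; apply: sJ; rewrite in_cons xs orbT.
  have vJ : v \in J by apply: sJ; rewrite mem_head.
  have [IH1 IH2] := IH us sJ'.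
  have -> : \bigcap_(x in [set` v :: s]) A x =
      A v `&` \bigcap_(x in [set` s]) A x.
    apply/seteqP; split=> [w Aw|w [Avw Asw] x /=]; last first.
      by rewrite in_cons => /orP[/eqP ->//|/Asw].
    split=> [|x xs]; first by apply: Aw; rewrite /= mem_head.
    by apply: Aw; rewrite /= in_cons; apply/orP; right.
  rewrite !big_cons; split.
    rewrite -IH1.
    apply: (independent_disjoint_families (S1 := T v)
      (S2 := \bigcup_(x <- s) T x)%SET indS).
    - exact: TS.
    - apply: sub_bigcup => x xs; exact/TS/sJ'.
    - apply/eqP; rewrite finset.setI_eq0 disjoint_sym finset.disjoints_subset.
      apply: sub_bigcup => x xs; rewrite -finset.disjoints_subset -finset.setI_eq0.
      by apply/eqP/Tdisj; apply: contraNneq vs => <-.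
    - exact: sA.
    - exact: IH2.
  have H1 : sigma_of D (T v :|: \bigcup_(x <- s) T x)%SET (A v).
    by apply: sigma_of_sub (sA v vJ); exact: finset.subsetUl.
  have H2 : sigma_of D (T v :|: \bigcup_(x <- s) T x)%SET (\bigcap_(x in [set` s]) A x).
    by apply: sigma_of_sub IH2; exact: finset.subsetUr.
  exact: (@measurableI _ (g_sigma_algebraType
    (coordinate_events (T v :|: \bigcup_(x <- s) T x)%SET))).
have [//|] := key (enum J) (enum_uniq _).
  by move=> x; rewrite mem_enum.
rewrite big_enum/= => <- _; congr (Pr _).
suff -> : [set` enum J] = [set` J] by [].
by apply/seteqP; split=> x /=; rewrite mem_enum.
Qed.

End independence.

(** * Counting independent rare events *)

Lemma prod_indic (R : realType) (T : Type) (K : finType) (A : K -> set T)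
    (J : {set K}) (w : T) :
  \prod_(v in J) \1_(A v) w = \1_(\bigcap_(v in [set` J]) A v) w :> R.
Proof.
rewrite indicE; case: (boolP (w \in _)) => [|/negP wA].
  rewrite inE => wA; rewrite big1// => v vJ.
  by rewrite indicE mem_set//; exact: wA.
have [v vJ wv] : exists2 v, v \in J & ~ A v w.
  apply: contrapT => nA; apply: wA; rewrite inE => v /= vJ.
  by apply: contrapT => wv; apply: nA; exists v.
by rewrite (bigD1 v)//= indicE memNset// mul0r.
Qed.

Lemma union_bound (R : realType) (dO : measure_display)
    (Omega : measurableType dO) (Pr : probability Omega R)
    (I : finType) (A : I -> set Omega) (p : R) :
  (forall i, measurable (A i)) -> (forall i, (Pr (A i) <= p%:E)%E) ->
  measurable (\bigcup_i A i) /\ (Pr (\bigcup_i A i) <= (#|I|%:R * p)%:E)%E.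
Proof.
move=> mA pA.
have -> : \bigcup_i A i = \big[setU/set0]_(i <- enum I) A i.
  rewrite -bigcup_seq; apply: eq_bigcupl; split=> i _ //=.
  by rewrite mem_enum.
rewrite cardE; elim: (enum I) => [|i s [mU IH]].
  by rewrite big_nil measure0 mul0r; split.
rewrite big_cons /= -natr1 mulrDl mul1r addrC EFinD; split.
  exact: measurableU.
apply: le_trans (leeD (pA i) IH); exact: measureU2.
Qed.

(** With [c = exp lambda - 1], the variable [exp (lambda * count)] is the product
    of the [1 + c * \1_(A v)].  Expanding it over subsets [J] of [K] only involves
    the probabilities of the intersections of the [A v] for [v] in [J], which are
    products; resumming gives the product of the [1 + c * Pr (A v)], and Markov's
    inequality concludes.  Working on the expansion avoids independence of
    random variables altogether. *)
Lemma chernoff_count (R : realType) (dO : measure_display)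
    (Omega : measurableType dO) (Pr : probability Omega R)
    (I : finType) (A : I -> set Omega) (K : {set I}) (p lambda : R) (k : nat) :
  (forall v, v \in K -> measurable (A v)) ->
  (forall J : {set I}, J \subset K ->
     Pr (\bigcap_(v in [set` J]) A v) = (\prod_(v in J) Pr (A v))%E) ->
  (forall v, v \in K -> (Pr (A v) <= p%:E)%E) ->
  0 <= lambda ->
  measurable [set w | (k <= #|[set v in K | w \in A v]|)%N] ->
  (Pr [set w | (k <= #|[set v in K | w \in A v]|)%N] <=
     (expR (- (lambda * k%:R)) *
      (1 + (expR lambda - 1) * p) ^+ #|K|)%:E)%E.
Proof.
move=> mA indA pA l0 mB.
set B := [set w | _] in mB *; set c := expR lambda - 1.
have c0 : 0 <= c by rewrite subr_ge0 -expR0 ler_expR.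
(* with this factor, a subset J not contained in K contributes nothing *)
pose g v := c * (v \in K)%:R.
have g0 v : 0 <= g v by rewrite mulr_ge0.
pose q v := fine (Pr (A v)).
have expand (h : I -> R) : \prod_v (1 + g v * h v) =
    \sum_(J in {set I}) \prod_(v in J) g v * \prod_(v in J) h v.
  under eq_bigr do rewrite addrC.
  rewrite bigA_distr; apply: eq_bigr => J _.
  by rewrite -big_split/= [RHS]big_mkcond.
have KB w : expR (lambda * k%:R) * \1_B w <= \prod_v (1 + g v * \1_(A v) w).
  have -> : \prod_v (1 + g v * \1_(A v) w) =
      expR (lambda * #|[set v in K | w \in A v]|%:R).
    rewrite [lambda * _]mulrC expRM_natl -prodr_const.
    rewrite [RHS]big_mkcond/=; apply: eq_bigr => v _.
    rewrite inE /g indicE /c; case: (v \in K); case: (w \in A v) => /=;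
      by rewrite ?(mulr1,mulr0,addr0)// addrC subrK.
  rewrite indicE; case: (boolP (w \in B)) => [|_]; last first.
    by rewrite mulr0 expR_ge0.
  by rewrite inE mulr1 ler_expR => kB; rewrite ler_wpM2l// ler_nat.
have step (J : {set I}) :
    ((\prod_(v in J) g v)%:E * Pr (\bigcap_(v in [set` J]) A v))%E =
    (\prod_(v in J) g v * \prod_(v in J) q v)%:E :> \bar R.
  have [JK|/fintype.subsetPn[v vJ vK]] := boolP (J \subset K).
    rewrite indA// EFinM -!prodEFin; congr (_ * _)%E; apply: eq_bigr => v vJ.
    by rewrite fineK// fin_num_measure//; apply/mA/(fintype.subsetP JK).
  have -> : \prod_(v in J) g v = 0.
    by rewrite (bigD1 v)//= {1}/g (negbTE vK) mulr0 mul0r.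
  by rewrite mul0r mul0e.
have mAJ (J : {set I}) : measurable (\bigcap_(v in [set` J]) A v) \/
    \prod_(v in J) g v = 0.
  have [JK|/fintype.subsetPn[v vJ vK]] := boolP (J \subset K).
    left; apply: fin_bigcap_measurable => [|v /= vJ].
      exact: finite_finset.
    exact/mA/(fintype.subsetP JK).
  by right; rewrite (bigD1 v)//= {1}/g (negbTE vK) mulr0 mul0r.
have mF (J : {set I}) : measurable_fun setT (fun w =>
    (\prod_(v in J) g v * \1_(\bigcap_(v in [set` J]) A v) w)%:E).
  apply/measurable_EFinP.
  have [mJ|->] := mAJ J; first exact: measurable_funM.
  by under eq_fun do rewrite mul0r; exact: measurable_cst.
have intY : (\int[Pr]_w (\prod_v (1 + g v * \1_(A v) w))%:E)%E =
    (\prod_v (1 + g v * q v))%:E.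
  under eq_integral do rewrite expand -sumEFin.
  under eq_integral do under eq_bigr do rewrite prod_indic.
  rewrite ge0_integral_sum//; last first.
    by move=> J w _; rewrite lee_fin mulr_ge0// prodr_ge0.
  rewrite expand -sumEFin; apply: eq_bigr => J _; rewrite -step.
  have [mJ|->] := mAJ J; last first.
    under eq_integral do rewrite mul0r.
    by rewrite integral0 mul0e.
  under eq_integral do rewrite EFinM.
  rewrite ge0_integralZl_EFin//; last 2 first.
    by apply/measurable_EFinP.
    by rewrite prodr_ge0.
  by rewrite integral_indic// setIT.
have main : ((expR (lambda * k%:R))%:E * Pr B <= (\prod_v (1 + g v * q v))%:E)%E.
  rewrite -intY -[in leLHS](setIT B) -integral_indic//.
  rewrite -ge0_integralZl_EFin//; last first.
    by apply/measurable_EFinP.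
  apply: ge0_le_integral => //.
  - by apply: measurable_funeM; apply/measurable_EFinP.
  - under eq_fun do rewrite expand -sumEFin.
    apply: emeasurable_fun_sum => J.
    by under eq_fun do rewrite prod_indic; exact: mF.
  - by move=> w _; rewrite -EFinM lee_fin.
rewrite expRN EFinM muleC lee_pdivlMr ?expR_gt0// muleC.
apply: le_trans main _; rewrite lee_fin.
rewrite -prodr_const [leRHS]big_mkcond/=; apply: ler_prod => v _.
rewrite /g; case: ifPn => vK; last by rewrite mulr0 mul0r addr0 ler01 lexx.
have qp : q v <= p.
  by rewrite -lee_fin fineK ?pA// fin_num_measure//; exact: mA.
have q0 : 0 <= q v by rewrite fine_ge0.
by rewrite mulr1 addr_ge0 ?mulr_ge0//= lerD2l ler_wpM2l.
Qed.

(** The cube of [exp (- 1 / 6) >= 5 / 6] bounds [exp (- 1 / 2)] from below; the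
    square of [exp (- 1 / 4) >= 3 / 4] would give [16 / 9], which is too large. *)
Lemma expR_half_le (R : realType) : expR (2^-1) <= 7 / 4 :> R.
Proof.
have h : 5 / 6 <= expR (- 6^-1) :> R.
  by apply: le_trans (expR_ge1Dx _); lra.
have h3 : (5 / 6) ^+ 3 <= expR (- 2^-1) :> R.
  have -> : - 2^-1 = 3%:R * - 6^-1 :> R by lra.
  by rewrite expRM_natl ler_pXn2r// nnegrE ?expR_ge0//; lra.
have : expR (2^-1) * expR (- 2^-1) = 1 :> R by rewrite -expRD subrr expR0.
have := expR_gt0 (2^-1 : R).
move: h3; move: (expR _) (expR _) => x y; rewrite !exprS expr0; nra.
Qed.

(** [K] is the number of clean blocks, [V - K] the number of contaminated ones
    and [k] the number of deviating clean blocks.  As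
    [1 + (exp (1/2) - 1) / 8 <= 1 + 3 / 32 <= exp (3 / 32)], the exponent is at most
    [- k / 2 + 3 K / 32], and this is at most [- V / 48], with equality when
    [V - K = V / 3] and [k = V / 2 - (V - K)]. *)
Lemma chernoff_majority (R : realType) (V K k : nat) :
  (K <= V)%N -> (3 * (V - K) <= V)%N -> (V <= 2 * ((V - K) + k))%N ->
  expR (- (2^-1 * k%:R)) * (1 + (expR 2^-1 - 1) * 8^-1) ^+ K <=
    expR (- (V%:R / 48)) :> R.
Proof.
move=> KV h1 h2.
have b : 1 + (expR 2^-1 - 1) * 8^-1 <= expR (3 / 32) :> R.
  apply: (@le_trans _ _ (1 + 3 / 32)); last exact: expR_ge1Dx.
  by have := expR_half_le R; lra.
have b0 : 0 <= 1 + (expR 2^-1 - 1) * 8^-1 :> R.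
  by have := expR_gt0 (2^-1 : R); lra.
apply: (@le_trans _ _ (expR (- (2^-1 * k%:R)) * expR (3 / 32) ^+ K)).
  by rewrite ler_wpM2l ?expR_ge0// lerXn2r// nnegrE expR_ge0.
rewrite -expRM_natl -expRD ler_expR.
move: h1 h2; rewrite -!(ler_nat R) !natrM natrD natrB//.
by move=> h1 h2; lra.
Qed.

(** * Decoupling the training data from the test data *)

Section pair_law.
Context (R : realType) (dO d1 d2 : measure_display)
  (Omega : measurableType dO) (Pr : probability Omega R)
  (T1 : measurableType d1) (T2 : measurableType d2)
  (U : {mfun Omega >-> T1}) (W : {mfun Omega >-> T2}).
Hypothesis UW : forall A B, measurable A -> measurable B ->
  Pr (U @^-1` A `&` W @^-1` B) = (Pr (U @^-1` A) * Pr (W @^-1` B))%E.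

Let mUW : measurable_fun setT (fun w => (U w, W w)).
Proof. exact: measurable_fun_pair. Qed.

Lemma independent_pair_law (C : set (T1 * T2)) : measurable C ->
  Pr ((fun w => (U w, W w)) @^-1` C) =
  (distribution Pr U \x distribution Pr W)%E C.
Proof.
move=> mC.
pose UW' : {mfun Omega >-> (T1 * T2)%type} := mfun_Sub (mem_set mUW).
by rewrite (product_measure_unique _ _ (m' := distribution Pr UW')).
Qed.

(** Under the product law, the probability of [C] is the mean of the
    probabilities of its sections; this plays the role of conditioning on [U]. *)
Lemma decoupling (C : set (T1 * T2)) (p : R) : measurable C ->
  (forall w, (Pr [set w' | C (U w, W w')] <= p%:E)%E) ->
  (Pr [set w | C (U w, W w)] <= p%:E)%E.
Proof.
move=> mC hp; rewrite [leLHS](independent_pair_law mC) /product_measure1.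
rewrite ge0_integral_distribution//; last first.
  exact: measurable_fun_xsection.
apply: (@le_trans _ _ (\int[Pr]_w (cst p%:E w))%E); last first.
  by rewrite integral_cst//= [X in (_ * X)%E]probability_setT mule1.
apply: ge0_le_integral => //.
- apply: measurableT_comp => //; exact: measurable_fun_xsection.
- move=> w _ /=; rewrite /distribution /pushforward.
  apply: le_trans (hp w); rewrite le_eqVlt; apply/orP; left; apply/eqP.
  congr (Pr _); apply/seteqP; split=> w' /=; rewrite /xsection/= ?inE//.
Qed.

End pair_law.

(** * Second moments and Chebyshev's inequality *)

Section second_moments.
Context (R : realType) (d : measure_display) (T : measurableType d)
  (P : probability T R).

Lemma Lfun2_sqr_lty (f : T -> R) : measurable_fun setT f ->
  ('E_P[fun x => (f x ^+ 2)%R] < +oo)%E -> f \in Lfun P 2%:E.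
Proof.
move=> mf; rewrite unlock => f2.
rewrite inE; apply/andP; split; rewrite inE//= /finite_norm.
rewrite unlock.
apply: poweR_lty; apply: le_lt_trans f2.
rewrite le_eqVlt; apply/orP; left; apply/eqP; apply: eq_integral => x _.
by rewrite /= powR_mulrn// real_normK// num_real.
Qed.

Lemma Lfun2_Lfun1 : {subset Lfun P 2%:E <= Lfun P 1}.
Proof. by apply: Lfun_subset12; rewrite fin_num_measure. Qed.

Lemma variance_sum_uncorrelated (I : eqType) (s : seq I) (X : I -> T -> R) :
  uniq s -> (forall i, i \in s -> X i \in Lfun P 2%:E) ->
  (forall i j, i \in s -> j \in s -> i != j -> covariance P (X i) (X j) = 0%E) ->
  ('V_P[(\sum_(i <- s) X i)%R] = \sum_(i <- s) 'V_P[X i])%E.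
Proof.
elim: s => [_ _ _|i s IH /= /andP[is_ us] L2 cov0].
  rewrite !big_nil -[0]/(cst 0); exact: variance_cst.
have L2s j : j \in s -> X j \in Lfun P 2%:E.
  by move=> js; apply: L2; rewrite in_cons js orbT.
have is2 : X i \in Lfun P 2%:E by apply: L2; rewrite mem_head.
have sum2 (r : seq I) : {subset r <= s} -> \sum_(j <- r) X j \in Lfun P 2%:E.
  have le12 : (1 <= 2%:E :> \bar R)%E by rewrite lee1n.
  by move=> rs; rewrite big_seq; apply: rpred_sum => j /rs; exact: L2s.
rewrite !big_cons -[X i + _]/(X i \+ _) varianceD ?sum2// IH//; last first.
  by move=> j k js ks; apply: cov0; rewrite in_cons ?js ?ks orbT.
suff -> : covariance P (X i) (\sum_(j <- s) X j) = 0%E by rewrite mule0 adde0.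
have : {subset s <= s} by [].
elim: {-2}s => [_|j r IHr rs].
  by rewrite big_nil -[0]/(cst 0); exact: covariance_cst_r.
have rs' : {subset r <= s} by move=> k kr; apply: rs; rewrite in_cons kr orbT.
have js : j \in s by apply: rs; rewrite mem_head.
rewrite big_cons.
have -> : covariance P (X i) (X j + \sum_(k <- r) X k)%R =
    (covariance P (X i) (X j) + covariance P (X i) (\sum_(k <- r) X k)%R)%E.
  by apply: covarianceDr; [exact: is2|exact: L2s|exact: sum2].
rewrite IHr// cov0 ?adde0//.
- by rewrite mem_head.
- by rewrite in_cons js orbT.
- by apply: contraNneq is_ => ->.
Qed.

(** The joint law is a product measure, so the mean of the product factors by
    Fubini's theorem. *)
Lemma independent_covariance0 (X Y : {mfun T >-> R}) :
  (X : T -> R) \in Lfun P 2%:E -> (Y : T -> R) \in Lfun P 2%:E ->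
  (forall A B, measurable A -> measurable B ->
    P (X @^-1` A `&` Y @^-1` B) = (P (X @^-1` A) * P (Y @^-1` B))%E) ->
  covariance P X Y = 0%E.
Proof.
move=> X2 Y2 XY.
have X1 := Lfun2_Lfun1 X2; have Y1 := Lfun2_Lfun1 Y2.
have XY1 : (X : T -> R) * (Y : T -> R) \in Lfun P 1 by exact: Lfun2_mul_Lfun1.
rewrite covarianceE//.
suff -> : ('E_P[(X : T -> R) * (Y : T -> R)] = 'E_P[X] * 'E_P[Y])%E.
  by rewrite subee// fin_numM// expectation_fin_num.
have mXY : measurable_fun setT (fun w => (X w, Y w)).
  exact: measurable_fun_pair.
pose XY' : {mfun T >-> (R * R)%type} := mfun_Sub (mem_set mXY).
pose f (z : R * R) : \bar R := (z.1 * z.2)%:E.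
have mf : measurable_fun setT f.
  by apply/measurable_EFinP; apply: measurable_funM.
have fXY : P.-integrable setT (f \o XY') by move/Lfun1_integrable : XY1.
have law A : measurable A ->
    distribution P XY' A = (distribution P X \x distribution P Y)%E A.
  exact: independent_pair_law.
have intf : (distribution P X \x distribution P Y)%E.-integrable setT f.
  have /integrableP[_ fi] : (distribution P XY').-integrable setT f.
    exact: integrable_pushforward.
  apply/integrableP; split=> //; apply: le_lt_trans fi.
  rewrite le_eqVlt; apply/orP; left; apply/eqP.
  by apply: eq_measure_integral => A mA _; exact/esym/law.
rewrite unlock.
transitivity (\int[distribution P X \x distribution P Y]_z f z)%E.
  rewrite -[LHS](@integral_distribution _ _ _ _ _ P XY' f)//.
  by apply: eq_measure_integral => A mA _; exact: law.
rewrite -integral12_prod_meas1// /fubini_F /f/=.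
have id1 (Z : {mfun T >-> R}) : (Z : T -> R) \in Lfun P 1 ->
    (distribution P Z).-integrable setT EFin.
  move=> Z1; apply: integrable_pushforward => //.
  by move/Lfun1_integrable : Z1.
have EZ (Z : {mfun T >-> R}) : (Z : T -> R) \in Lfun P 1 ->
    (\int[distribution P Z]_x x%:E = \int[P]_w (Z w)%:E)%E.
  move=> Z1; rewrite integral_distribution//.
  by move/Lfun1_integrable : Z1.
under eq_integral do under eq_integral do rewrite EFinM.
under eq_integral do rewrite integralZl ?id1// EZ//.
have fY : (\int[P]_w (Y w)%:E)%E \is a fin_num.
  by have := expectation_fin_num Y1; rewrite unlock.
by rewrite -(fineK fY) integralZr ?id1// EZ.
Qed.

(** The strict inequality inside the event allows [t = 0]: the variance is then
    zero and the event is a countable union of events that Chebyshev's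
    inequality makes null.  This case occurs when both excess risks vanish. *)
Lemma chebyshev_gt (X : {mfun T >-> R}) (t p : R) :
  (X : T -> R) \in Lfun P 2%:E -> 0 <= t -> ('V_P[X] <= (p * t ^+ 2)%:E)%E ->
  0 <= p ->
  (P [set x | (t < `|X x - fine 'E_P[X]|)%R] <= p%:E)%E.
Proof.
move=> X2 t0 Vt p0.
pose Y : T -> R := fun x => X x - fine 'E_P[X]%E.
have mY : measurable_fun setT Y by exact: measurable_funB.
have mB (e : R) : measurable [set x | (e <= `|Y x|)%R].
  rewrite -[X in measurable X]setTI.
  apply: (measurable_fun_le (f := cst e) (g := fun x => `|Y x|)) => //.
  exact: measurableT_comp.
have mB' (e : R) : measurable [set x | (e < `|Y x|)%R].
  have -> : [set x | (e < `|Y x|)%R] = ~` [set x | (`|Y x| <= e)%R].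
    by apply/seteqP; split=> x /=; rewrite ltNge => /negP.
  apply: measurableC; rewrite -[X in measurable X]setTI.
  apply: (measurable_fun_le (f := fun x => `|Y x|) (g := cst e)) => //.
  exact: measurableT_comp.
move: t0; rewrite le_eqVlt => /orP[/eqP t0|t0]; last first.
  apply: (@le_trans _ _ (P [set x | (t <= `|Y x|)%R])).
    apply: le_measure; [by rewrite inE; exact: mB'|by rewrite inE; exact: mB|].
    by move=> x /= /ltW.
  apply: le_trans; first exact: (@chebyshev _ _ _ P X _ t0).
  rewrite lee_pdivrMl ?exprn_gt0//.
  by rewrite -EFinM mulrC.
rewrite -t0 expr0n/= mulr0 in Vt *.
suff -> : P [set x | (0 < `|Y x|)%R] = 0%E by rewrite lee_fin.
have -> : [set x | (0 < `|Y x|)%R] = \bigcup_n [set x | (n.+1%:R^-1 <= `|Y x|)%R].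
  apply/seteqP; split=> [x /= Yx|x [n _ /=]]; last first.
    by apply: lt_le_trans; rewrite invr_gt0.
  have /ltr_add_invr[k] := Yx; rewrite add0r => /ltW kY.
  by exists k.
have mBn n : measurable [set x | (n.+1%:R^-1 <= `|Y x|)%R] by exact: mB.
apply/negligibleP; first exact: bigcupT_measurable.
apply: negligible_bigcup => n; apply/negligibleP => //.
have n0 : 0 < n.+1%:R^-1 :> R by rewrite invr_gt0.
apply/eqP; rewrite -measure_le0; apply: le_trans; first exact: (@chebyshev _ _ _ P X _ n0).
by rewrite pmule_rle0// lte_fin invr_gt0 exprn_gt0.
Qed.

End second_moments.

(** * Deviation of the mean of an informative block *)

Section iid_block.
Context (R : realType) (dO d : measure_display)
  (Omega : measurableType dO) (Pr : probability Omega R)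
  (Z : measurableType d) (P : probability Z R)
  (N : nat) (D : 'I_N -> Omega -> Z).
Hypothesis hD : forall i, measurable_fun setT (D i).
Variable S : {set 'I_N}.
Hypothesis hS : iid_with_law Pr D P S.

Lemma law_ge0_integral (i : 'I_N) (g : Z -> \bar R) : i \in S ->
  measurable_fun setT g -> (forall z, (0 <= g z)%E) ->
  (\int[Pr]_w g (D i w) = \int[P]_z g z)%E.
Proof.
move=> iS mg g0; pose Di : {mfun Omega >-> Z} := mfun_Sub (mem_set (hD i)).
rewrite -[LHS](@ge0_integral_distribution _ _ _ _ _ Pr Di)//.
by apply: eq_measure_integral => A mA _; exact: (hS.1 i A).
Qed.

Lemma law_expectation (i : 'I_N) (g : Z -> R) : i \in S ->
  measurable_fun setT g -> (g \o D i) \in Lfun Pr 1 ->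
  ('E_Pr[g \o D i] = 'E_P[g])%E.
Proof.
move=> iS mg g1; pose Di : {mfun Omega >-> Z} := mfun_Sub (mem_set (hD i)).
rewrite unlock -[LHS](@integral_distribution _ _ _ _ _ Pr Di (EFin \o g)).
- by apply: eq_measure_integral => A mA _; exact: (hS.1 i A).
- exact/measurable_EFinP.
- by move/Lfun1_integrable : g1.
Qed.

Lemma block_mean_deviation (B : {set 'I_N}) (h : Z -> R) (Q t : R) :
  B \subset S -> (0 < #|B|)%N -> measurable_fun setT h ->
  ('E_P[fun z => (h z ^+ 2)%R] <= Q%:E)%E ->
  0 <= t -> 8 * Q <= #|B|%:R * t ^+ 2 ->
  (Pr [set w | (t < `|#|B|%:R^-1 * \sum_(i in B) h (D i w) -
                     fine 'E_P[h]%E|)%R] <= (8^-1)%:E)%E.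
Proof.
move=> BS B0 mh hQ t0 Qt.
have mX i : measurable_fun setT (h \o D i) by exact: measurableT_comp.
have BSi i : i \in B -> i \in S by move=> iB; exact: (fintype.subsetP BS).
have EX2 i : i \in B -> ('E_Pr[fun w => ((h \o D i) w ^+ 2)%R] <= Q%:E)%E.
  move=> iB; rewrite unlock.
  rewrite (@law_ge0_integral i (fun z => (h z ^+ 2)%:E) (BSi _ iB)).
  - by move: hQ; rewrite unlock.
  - by apply/measurable_EFinP; exact: measurable_funX.
  - by move=> z; rewrite lee_fin sqr_ge0.
have X2 i : i \in B -> h \o D i \in Lfun Pr 2%:E.
  by move=> iB; apply: Lfun2_sqr_lty => //; apply: le_lt_trans (EX2 i iB) (ltry _).
have EX i : i \in B -> ('E_Pr[h \o D i] = 'E_P[h])%E.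
  by move=> iB; apply: law_expectation => //; [exact: BSi|exact/Lfun2_Lfun1/X2].
have VX i : i \in B -> ('V_Pr[h \o D i] <= Q%:E)%E.
  move=> iB; rewrite varianceE; last exact: X2.
  apply: le_trans (EX2 i iB).
  by rewrite leeBlDr ?fin_numX ?expectation_fin_num ?Lfun2_Lfun1 ?X2// leeDl// sqre_ge0.
pose X i : {mfun Omega >-> R} := mfun_Sub (mem_set (mX i)).
have cov0 i j : i \in B -> j \in B -> i != j ->
    covariance Pr (h \o D i) (h \o D j) = 0%E.
  move=> iB jB ij; apply: (@independent_covariance0 _ _ _ Pr (X i) (X j)).
  - exact: X2.
  - exact: X2.
  - move=> A1 A2 mA1 mA2.
    have mh1 A : measurable A -> measurable (h @^-1` A).
      by move=> mA; rewrite -[_ @^-1` _]setTI; exact: mh.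
    apply: (independent_disjoint_families hD (S1 := [set i]%SET)
      (S2 := [set j]%SET) hS.2).
    + by rewrite finset.sub1set BSi.
    + by rewrite finset.sub1set BSi.
    + apply/finset.setP => k; rewrite !inE.
      by case: (eqVneq k i) => [->|//]; rewrite (negbTE ij).
    + apply: sub_sigma_algebra; exists i, (h @^-1` A1).
      by rewrite finset.set11; split=> //; exact: mh1.
    + apply: sub_sigma_algebra; exists j, (h @^-1` A2).
      by rewrite finset.set11; split=> //; exact: mh1.
pose sumX := (\sum_(i <- enum B) (h \o D i))%R : Omega -> R.
have sumXE w : sumX w = \sum_(i in B) h (D i w).
  by rewrite /sumX fct_sumE big_enum.
have msum : measurable_fun setT sumX.
  have -> : sumX = fun w => \sum_(i <- enum B) (h \o D i) w.
    by apply/funext => w; rewrite /sumX fct_sumE.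
  exact: measurable_sum.
have sum2 : sumX \in Lfun Pr 2%:E.
  have le12 : (1 <= 2%:E :> \bar R)%E by rewrite lee1n.
  by rewrite /sumX big_seq; apply: rpred_sum => i; rewrite mem_enum => /X2.
have Vsum : ('V_Pr[sumX] <= (#|B|%:R * Q)%:E)%E.
  rewrite /sumX variance_sum_uncorrelated ?enum_uniq//.
  - rewrite big_enum/=; apply: (@le_trans _ _ (\sum_(i in B) Q%:E)%E).
      by apply: lee_sum => i iB; exact: VX.
    by rewrite sumEFin sumr_const mulr_natl.
  - by move=> i; rewrite mem_enum; exact: X2.
  - by move=> i j; rewrite !mem_enum; exact: cov0.
have B0R : 0 < #|B|%:R :> R by rewrite ltr0n.
pose a : R := #|B|%:R^-1.
pose Y : Omega -> R := fun w => sumX w * a.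
have mY : measurable_fun setT Y by apply: measurable_funM.
pose Y' : {mfun Omega >-> R} := mfun_Sub (mem_set mY).
have EY : 'E_Pr[Y]%E = 'E_P[h]%E.
  rewrite -[Y]/(a \o* sumX)%R expectationZl; last exact: Lfun2_Lfun1.
  have [i iB] : exists i, i \in B by apply/set0Pn; rewrite -card_gt0.
  have Eh : 'E_P[h]%E \is a fin_num.
    by rewrite -(EX i iB) expectation_fin_num// Lfun2_Lfun1// X2.
  rewrite /sumX -(big_map (fun i => h \o D i) xpredT id) expectation_sum; last first.
    by move=> f /mapP[j]; rewrite mem_enum => jB ->; exact/Lfun2_Lfun1/X2.
  rewrite big_map big_enum/= (eq_bigr (fun=> (fine 'E_P[h])%:E)%E); last first.
    by move=> j jB; rewrite EX// fineK.
  rewrite sumEFin sumr_const -mulr_natl -EFinM mulrA mulVf ?mul1r ?fineK//.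
  exact: lt0r_neq0.
have VY : ('V_Pr[Y] <= (8^-1 * t ^+ 2)%:E)%E.
  rewrite -[Y]/(a \o* sumX)%R varianceZ//.
  apply: (@le_trans _ _ ((a ^+ 2)%:E * (#|B|%:R * Q)%:E)%E).
    by rewrite lee_wpmul2l// lee_fin sqr_ge0.
  rewrite -EFinM lee_fin.
  have -> : a ^+ 2 * (#|B|%:R * Q) = a * Q.
    by rewrite expr2 -!mulrA (mulrA a #|B|%:R) mulVf ?mul1r//; exact: lt0r_neq0.
  by rewrite mulrC ler_pdivrMr//; lra.
have -> : [set w | (t < `|#|B|%:R^-1 * \sum_(i in B) h (D i w) -
      fine 'E_P[h]%E|)%R] = [set w | (t < `|Y' w - fine 'E_Pr[Y']%E|)%R].
  by apply/seteqP; split=> w /=; rewrite EY/= /Y sumXE mulrC.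
apply: chebyshev_gt => //.
by apply: Lfun_scale => //; rewrite ler1n.
Qed.

End iid_block.
(** * Moments of the loss increments *)

Lemma expectation_sqrB (R : realType) (d : measure_display)
    (T : measurableType d) (P : probability T R) (X Y : T -> R) (a : R) :
  X \in Lfun P 2%:E -> Y \in Lfun P 2%:E ->
  fine 'E_P[fun z => ((X z - a * Y z) ^+ 2)%R] =
  fine 'E_P[fun z => (X z ^+ 2)%R] - 2 * a * fine 'E_P[fun z => (X z * Y z)%R] +
  a ^+ 2 * fine 'E_P[fun z => (Y z ^+ 2)%R].
Proof.
move=> X2 Y2.
have XX : (fun z => X z ^+ 2) \in Lfun P 1.
  by apply/Lfun1_integrable; exact: Lfun2_integrable_sqr.
have YY : (fun z => Y z ^+ 2) \in Lfun P 1.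
  by apply/Lfun1_integrable; exact: Lfun2_integrable_sqr.
have XY : (fun z => X z * Y z) \in Lfun P 1 by exact: Lfun2_mul_Lfun1.
have -> : (fun z => (X z - a * Y z) ^+ 2) =
    ((fun z => X z ^+ 2) \+ ((- (2 * a)) \o* (fun z => X z * Y z)%R)) \+
    ((a ^+ 2) \o* (fun z => Y z ^+ 2)).
  by apply/funext => z /=; rewrite !expr2; lra.
have l1 : ((- (2 * a)) \o* (fun z => X z * Y z)%R) \in Lfun P 1 by exact: Lfun_scale.
have l2 : ((a ^+ 2) \o* (fun z => Y z ^+ 2)) \in Lfun P 1 by exact: Lfun_scale.
rewrite expectationD//; last by rewrite rpredD.
rewrite expectationD// !expectationZl//.
rewrite !fineD ?fin_numD ?fin_numM ?expectation_fin_num//.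
by rewrite !fineM ?expectation_fin_num//= mulNr.
Qed.

Section least_squares.
Context (R : realType) (d : measure_display) (X : measurableType d)
  (P : probability (X * R)%type R) (F : set (X -> R)) (fstar : X -> R).
Hypothesis hY : ('E_P[fun z : X * R => (z.2 ^+ 2)%R] < +oo)%E.
Hypothesis hF : L2_subspace P F.
Hypothesis hfstar : is_oracle P F fstar.

Lemma estimator_measurable f : F f -> measurable_fun setT f.
Proof. by case: hF => h _ _ /h[]. Qed.

Lemma estimator_Lfun2 f : F f -> (fun z : X * R => f z.1) \in Lfun P 2%:E.
Proof.
move=> Ff; apply: Lfun2_sqr_lty; last by case: hF => h _ _; case: (h _ Ff).
exact: measurableT_comp (estimator_measurable Ff) _.
Qed.

Lemma subspace_line f g a : F f -> F g ->
  F (fun x => g x + a * (f x - g x)).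
Proof.
case: hF => _ _ h Ff Fg.
have -> : (fun x => g x + a * (f x - g x)) =
    (fun x => a * f x + (- a * g x + g x)).
  by apply/funext => x; lra.
exact/h/h.
Qed.

Lemma subspace_sub f g : F f -> F g -> F (fun x => f x - g x).
Proof.
case: hF => _ _ h Ff Fg.
have -> : (fun x => f x - g x) = (fun x => -1 * g x + f x).
  by apply/funext => x; lra.
exact: h.
Qed.

Lemma residual_Lfun2 f : F f ->
  (fun z : X * R => z.2 - f z.1) \in Lfun P 2%:E.
Proof.
move=> Ff; have le12 : (1 <= 2%:E :> \bar R)%E by rewrite lee1n.
have Y2 : (fun z : X * R => z.2) \in Lfun P 2%:E.
  by apply: Lfun2_sqr_lty => //; exact: measurable_snd.
exact: (rpredB Y2 (estimator_Lfun2 Ff)).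
Qed.

Lemma dev_Lfun2 f : F f ->
  (fun z : X * R => f z.1 - fstar z.1) \in Lfun P 2%:E.
Proof.
case: hfstar => Fs _ Ff.
exact: (estimator_Lfun2 (subspace_sub Ff Fs)).
Qed.

Lemma loss_Lfun1 f : F f -> loss f \in Lfun P 1.
Proof.
move=> Ff; apply/Lfun1_integrable.
exact: (Lfun2_integrable_sqr (residual_Lfun2 Ff)).
Qed.

Lemma risk_fin_num f : F f -> risk P f \is a fin_num.
Proof. by move=> Ff; exact/expectation_fin_num/loss_Lfun1. Qed.

(** The squared distance of [f] to the oracle in the space of square-integrable
    functions of [X]. *)
Definition sqdist (f : X -> R) : R :=
  fine 'E_P[fun z => ((f z.1 - fstar z.1) ^+ 2)%R]%E.

(** Along a line through the oracle the risk is a quadratic polynomial, whose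
    linear term is the correlation of the deviation with the noise. *)
Lemma risk_line f a : F f ->
  fine (risk P (fun x => fstar x + a * (f x - fstar x))) =
  fine (risk P fstar) -
    2 * a * fine 'E_P[fun z => ((z.2 - fstar z.1) * (f z.1 - fstar z.1))%R]%E +
    a ^+ 2 * sqdist f.
Proof.
move=> Ff; have [Fs _] := hfstar.
rewrite -(expectation_sqrB a (residual_Lfun2 Fs) (dev_Lfun2 Ff)).
rewrite /risk; congr (fine 'E_P[_]%E); apply/funext => z.
by rewrite /loss opprD addrA.
Qed.

Lemma sqdist_ge0 f : 0 <= sqdist f.
Proof. by rewrite fine_ge0// expectation_ge0// => z; rewrite sqr_ge0. Qed.

Lemma sqdistE f : F f ->
  'E_P[fun z : X * R => ((f z.1 - fstar z.1) ^+ 2)%R]%E = (sqdist f)%:E.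
Proof.
move=> Ff; rewrite /sqdist fineK//; apply/expectation_fin_num/Lfun1_integrable.
exact: Lfun2_integrable_sqr (dev_Lfun2 Ff).
Qed.

(** The quadratic [a^2 A - 2 a B] of [risk_line] is nonnegative for all [a], which
    forces [B <= 0]; at [a = 1] the excess risk is [A - 2 B]. *)
Lemma sqdist_le_excess_risk f : F f -> sqdist f <= excess_risk P fstar f.
Proof.
move=> Ff; have [Fs min_fs] := hfstar.
set A := sqdist f.
pose B := fine 'E_P[fun z => ((z.2 - fstar z.1) * (f z.1 - fstar z.1))%R]%E.
have quad a : 0 <= a ^+ 2 * A - 2 * a * B.
  have Fa := subspace_line a Ff Fs.
  have := min_fs _ Fa.
  rewrite -(fineK (risk_fin_num Fs)) -(fineK (risk_fin_num Fa)) lee_fin.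
  by rewrite risk_line// -/A -/B; lra.
have A0 : 0 <= A := sqdist_ge0 f.
have B0 : B <= 0.
  rewrite leNgt; apply/negP => B0.
  have A1 : 0 < A + 1 by rewrite ltr_wpDl.
  (* near the minimizer B / A of the quadratic, shifted so that A = 0 is allowed *)
  have := quad (B / (A + 1)).
  have : B = (A + 1) * (B / (A + 1)) by rewrite mulrC divfK// lt0r_neq0.
  have : 0 < B / (A + 1) by rewrite divr_gt0.
  move: (B / (A + 1)) => c c0 ->; rewrite expr2; nra.
have := risk_line 1 Ff; rewrite -/A -/B.
have -> : (fun x => fstar x + 1 * (f x - fstar x)) = f.
  by apply/funext => x; lra.
by rewrite /excess_risk => ->; lra.
Qed.

Lemma excess_risk_ge0 f : F f -> 0 <= excess_risk P fstar f.
Proof.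
by move=> Ff; apply: le_trans (sqdist_le_excess_risk Ff); exact: sqdist_ge0.
Qed.

Lemma expectation_loss_diff f g : F f -> F g ->
  fine 'E_P[fun z => (loss f z - loss g z)%R]%E =
  excess_risk P fstar f - excess_risk P fstar g.
Proof.
move=> Ff Fg.
have -> : (fun z => loss f z - loss g z) = loss f \- loss g by [].
rewrite expectationB ?loss_Lfun1// fineB ?risk_fin_num// /excess_risk /risk.
lra.
Qed.

Lemma loss_measurable f : F f -> measurable_fun setT (loss f).
Proof.
by move=> /residual_Lfun2; rewrite inE => /andP[]; rewrite inE => mf _;
  exact: measurable_funX.
Qed.

Variables (chi sigma : R).
Hypothesis hchi : 0 < chi.
Hypothesis hL4 : forall f, F f ->
  ('E_P[fun z : X * R => (f z.1 ^+ 4)%R] `^ (4^-1)%R <=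
   chi%:E * 'E_P[fun z : X * R => (f z.1 ^+ 2)%R] `^ (2^-1)%R)%E.
Hypothesis hL2 : forall f, F f ->
  ('E_P[fun z : X * R =>
      ((z.2 - fstar z.1) ^+ 2 * (f z.1 - fstar z.1) ^+ 2)%R] <=
   (sigma ^+ 2)%:E * 'E_P[fun z : X * R => ((f z.1 - fstar z.1) ^+ 2)%R])%E.

(** The deviation [f - fstar] belongs to [F], so the fourth-moment hypothesis
    applies to it; raising it to the fourth power makes it polynomial. *)
Lemma fourth_moment_le f : F f ->
  ('E_P[fun z : X * R => ((f z.1 - fstar z.1) ^+ 4)%R] <=
   (chi ^+ 4 * (excess_risk P fstar f) ^+ 2)%:E)%E.
Proof.
move=> Ff; have [Fs _] := hfstar.
have := hL4 (subspace_sub Ff Fs).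
rewrite sqdistE//.
have : (0 <= 'E_P[fun z : X * R => ((f z.1 - fstar z.1) ^+ 4)%R])%E.
  by apply: expectation_ge0 => z; rewrite exprn_even_ge0.
have s0 := sqdist_ge0 f; have sl := sqdist_le_excess_risk Ff.
case: ('E_P[_])%E => [r||]; last 2 first.
- by rewrite poweR_EFin -EFinM poweRyr ?gt_eqF ?invr_gt0// leye_eq.
- by [].
rewrite lee_fin => r0; rewrite !poweR_EFin -EFinM !lee_fin => h.
have : (r `^ 4^-1) ^+ 4 <= (chi * sqdist f `^ 2^-1) ^+ 4.
  by rewrite lerXn2r// nnegrE ?mulr_ge0 ?powR_ge0 ?ltW.
rewrite -[in X in X -> _](powR_mulrn 4 (powR_ge0 _ _)) -powRrM mulVf// powRr1//.
move=> /le_trans; apply; rewrite exprMn ler_wpM2l ?exprn_ge0 ?(ltW hchi)//.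
have -> : (sqdist f `^ 2^-1) ^+ 4 = sqdist f ^+ 2.
  by rewrite -powR_mulrn ?powR_ge0// -powRrM -(@powR_mulrn _ _ 2)//; congr powR; lra.
by rewrite lerXn2r// nnegrE// (le_trans s0).
Qed.

Definition moment_bound (l l' : R) : R :=
  4 * chi ^+ 4 * (l ^+ 2 + l' ^+ 2) + 16 * sigma ^+ 2 * (l + l').

(** With [u h = h - fstar] and [xi = Y - fstar], the increment is the sum of the
    four terms [u f ^ 2], [- u g ^ 2], [- 2 xi u f], [2 xi u g]; the square of a
    sum of four terms is at most four times the sum of their squares. *)
Lemma loss_diff_second_moment f g : F f -> F g ->
  ('E_P[fun z => ((loss f z - loss g z) ^+ 2)%R] <=
   (moment_bound (excess_risk P fstar f) (excess_risk P fstar g))%:E)%E.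
Proof.
move=> Ff Fg; have [Fs _] := hfstar.
pose u (f : X -> R) (z : X * R) := f z.1 - fstar z.1.
pose xi (z : X * R) := z.2 - fstar z.1.
have mu h : F h -> measurable_fun setT (u h).
  by move=> /dev_Lfun2; rewrite inE => /andP[]; rewrite inE.
have mxi : measurable_fun setT xi.
  by have := residual_Lfun2 Fs; rewrite inE => /andP[]; rewrite inE.
pose m4 h z := (u h z ^+ 4)%:E; pose m2 h z := (xi z ^+ 2 * u h z ^+ 2)%:E.
have mm4 h : F h -> measurable_fun setT (m4 h).
  by move=> Fh; apply/measurable_EFinP; apply: measurable_funX; exact: mu.
have mm2 h : F h -> measurable_fun setT (m2 h).
  move=> Fh; apply/measurable_EFinP; apply: measurable_funM.
    exact: measurable_funX.
  by apply: measurable_funX; exact: mu.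
have m40 h z : (0 <= m4 h z)%E by rewrite lee_fin exprn_even_ge0.
have m20 h z : (0 <= m2 h z)%E by rewrite lee_fin mulr_ge0 ?sqr_ge0.
have b4 h : F h -> (\int[P]_z m4 h z <= (chi ^+ 4 * (excess_risk P fstar h) ^+ 2)%:E)%E.
  by move=> /fourth_moment_le; rewrite unlock.
have b2 h : F h -> (\int[P]_z m2 h z <= (sigma ^+ 2 * excess_risk P fstar h)%:E)%E.
  move=> Fh; have := hL2 Fh; rewrite sqdistE// unlock => /le_trans; apply.
  by rewrite -EFinM lee_fin ler_wpM2l ?sqr_ge0// sqdist_le_excess_risk.
have D0 h z : (0 <= m4 h z + 4%:E * m2 h z)%E by rewrite adde_ge0// mule_ge0.
have mD h : F h -> measurable_fun setT (fun z => m4 h z + 4%:E * m2 h z)%E.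
  move=> Fh; apply: emeasurable_funD; first exact: mm4.
  by apply: measurable_funeM; exact: mm2.
rewrite unlock.
apply: (@le_trans _ _ (\int[P]_z (4%:E * ((m4 f z + 4%:E * m2 f z) +
    (m4 g z + 4%:E * m2 g z))))%E).
  apply: ge0_le_integral => //.
  - by move=> z _; rewrite lee_fin sqr_ge0.
  - apply/measurable_EFinP; apply: measurable_funX.
    by apply: measurable_funB; exact: loss_measurable.
  - by apply: measurable_funeM; apply: emeasurable_funD; exact: mD.
  - move=> z _; rewrite -[leRHS]/((4 * ((u f z ^+ 4 + 4 * (xi z ^+ 2 * u f z ^+ 2)) +
      (u g z ^+ 4 + 4 * (xi z ^+ 2 * u g z ^+ 2))))%:E) lee_fin.
    have -> : loss f z - loss g z =
        u f z ^+ 2 - u g z ^+ 2 - 2 * (xi z * u f z) + 2 * (xi z * u g z).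
      by rewrite /loss /u /xi !expr2; lra.
    have e4 h : u h z ^+ 4 = (u h z ^+ 2) ^+ 2 by rewrite -exprM.
    rewrite !e4 -!exprMn; move: (u f z ^+ 2) (u g z ^+ 2) (xi z * u f z) (xi z * u g z).
    move=> x1 x2 x3 x4; rewrite !expr2.
    have := sqr_ge0 (x1 + x2); have := sqr_ge0 (x1 + 2 * x3).
    have := sqr_ge0 (x1 - 2 * x4); have := sqr_ge0 (x2 - 2 * x3).
    have := sqr_ge0 (x2 + 2 * x4); have := sqr_ge0 (2 * x3 + 2 * x4).
    by rewrite !expr2; nra.
have D h : F h -> (\int[P]_z (m4 h z + 4%:E * m2 h z) <=
    (chi ^+ 4 * (excess_risk P fstar h) ^+ 2 +
     4 * (sigma ^+ 2 * excess_risk P fstar h))%:E)%E.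
  move=> Fh; rewrite ge0_integralD//; last 3 first.
  - exact: mm4.
  - by move=> z _; exact: mule_ge0.
  - by apply: measurable_funeM; exact: mm2.
  rewrite ge0_integralZl_EFin//; last exact: mm2.
  exact: (leeD (b4 h Fh) (lee_wpmul2l _ (b2 h Fh))).
rewrite ge0_integralZl_EFin//; last 2 first.
- by move=> z _; exact: adde_ge0.
- by apply: emeasurable_funD; exact: mD.
rewrite ge0_integralD//; [|exact: mD|exact: mD].
apply: (le_trans (lee_wpmul2l _ (leeD (D f Ff) (D g Fg)))) => //.
rewrite -[leLHS]/((4 * ((chi ^+ 4 * excess_risk P fstar f ^+ 2 +
  4 * (sigma ^+ 2 * excess_risk P fstar f)) +
  (chi ^+ 4 * excess_risk P fstar g ^+ 2 +
  4 * (sigma ^+ 2 * excess_risk P fstar g))))%:E) lee_fin /moment_bound.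
lra.
Qed.

End least_squares.

Lemma moment_bound_ge0 (R : realType) (chi sigma l l' : R) :
  0 <= l -> 0 <= l' -> 0 <= moment_bound chi sigma l l'.
Proof.
move=> l0 l'0; apply: addr_ge0; apply: mulr_ge0; rewrite ?addr_ge0 ?sqr_ge0//.
  by rewrite mulr_ge0// exprn_even_ge0.
by rewrite mulr_ge0// sqr_ge0.
Qed.

(** * Medians, thresholds and minmax selection *)

(** More than half of the values are within [t] of [mu], while at least half of
    them are on either side of a median; some good value is met on each side. *)
Lemma median_close (R : realType) (V : nat) (u : 'I_V -> R) (x mu t : R) :
  is_median u x -> (2 * #|[set v | (t < `|u v - mu|)%R]%SET| < V)%N ->
  `|x - mu| <= t.
Proof.
move=> [ux xu] bad.
have meet (q : pred 'I_V) : (V <= 2 * #|q|)%N ->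
    exists2 v, q v & `|u v - mu| <= t.
  move=> qV; apply: contrapT => nq; move: bad; apply/negP; rewrite -leqNgt.
  apply: (leq_trans qV); rewrite leq_mul2l/=; apply/subset_leq_card.
  apply/fintype.subsetP => v qv; rewrite inE ltNge; apply/negP => vt.
  by apply: nq; exists v.
have [v /= vx vt] := meet _ ux; have [w /= xw wt] := meet _ xu.
move: vt wt; rewrite !ler_norml => /andP[v1 v2] /andP[w1 w2].
by apply/andP; split; lra.
Qed.

Lemma finmax_ge (R : realType) (I : finType) (i0 i : I) (u : I -> R) :
  u i <= finmax i0 u.
Proof. by rewrite /finmax; exact: le_bigmax. Qed.

Lemma finmax_le (R : realType) (I : finType) (i0 : I) (u : I -> R) (x : R) :
  (forall i, u i <= x) -> finmax i0 u <= x.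
Proof. by move=> ux; rewrite /finmax; apply: bigmax_le. Qed.

Lemma finmin_attained (R : realType) (I : finType) (i0 : I) (u : I -> R) :
  exists2 i, finmin i0 u = u i & forall j, u i <= u j.
Proof.
have ge j : finmin i0 u <= u j by rewrite /finmin; exact: bigmin_le.
suff [i ei] : exists i, finmin i0 u = u i by exists i => // j; rewrite -ei.
rewrite /finmin; elim/big_ind: _ => [|x y [i ->] [j ->]|i _]; last by exists i.
- by exists i0.
- by rewrite /Num.min; case: ifP => _; [exists i|exists j].
Qed.

(** When [a > 1] the left-hand side is nonpositive.  Otherwise the row of the best
    index [m0] has maximum at most [2 a l_m0 + b], because [- (1 - a) l_m'] is at
    most [- (1 - a) l_m0]; this is where the constant is [1 + 3 a] and not
    [2 + 2 a].  The row of [mhat] has a smaller maximum, which bounds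
    its entry at [m0]. *)
Lemma minmax_selection (R : realType) (M : finType) (l : M -> R)
    (T : M -> M -> R) (mhat : M) (a b : R) :
  (forall m, 0 <= l m) -> 0 <= a -> 0 <= b ->
  (forall m m', `|T m m' - (l m - l m')| <= a * (l m + l m') + b) ->
  is_argmin (fun m => finmax m (T m)) mhat ->
  (1 - a) * l mhat <= (1 + 3 * a) * finmin mhat l + 2 * b.
Proof.
move=> l0 a0 b0 close amin; have [m0 -> m0min] := finmin_attained mhat l.
have lh := l0 mhat; have l00 := l0 m0.
have [a1|a1] := leP a 1; last by nra.
have up : finmax m0 (T m0) <= 2 * a * l m0 + b.
  apply: finmax_le => m'; have := close m0 m'; have := m0min m'.
  by rewrite ler_norml => hm /andP[_ h2]; nra.
have lo : T mhat m0 <= finmax m0 (T m0).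
  exact: le_trans (finmax_ge mhat m0 (T mhat)) (amin m0).
have := close mhat m0; rewrite ler_norml => /andP[h1 _].
by lra.
Qed.

Lemma ler_sqrt_sqr (R : realType) (x y : R) : 0 <= y -> x <= y ^+ 2 ->
  Num.sqrt x <= y.
Proof. by move=> y0 xy; rewrite -(ger0_norm y0) -sqrtr_sqr ler_wsqrtr. Qed.

(** With [x = 8 chi^2 sqrt (2 V / N) (l + l')], [y = 2 sqrt 2 eps (l + l')] and
    [z = b], the fourth-moment part of the squared threshold is at most [x^2], and
    the noise part is at most [4 y z <= (y + z)^2]: the product [y z] is free
    of [eps], which is how one event serves all [eps]. *)
Lemma threshold_le (R : realType) (chi sigma l l' eps : R) (N V : nat) :
  (0 < N)%N -> 0 <= l -> 0 <= l' -> 0 < eps ->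
  Num.sqrt (32 * V%:R / N%:R * moment_bound chi sigma l l') <=
  a_const chi N V eps * (l + l') + b_const sigma N V eps.
Proof.
move=> N0 l0 l'0 e0; rewrite /a_const /b_const /moment_bound.
have n0 : 0 < N%:R :> R by rewrite ltr0n.
have v0 : 0 <= V%:R / N%:R :> R by rewrite divr_ge0.
set s : R := Num.sqrt (2 * V%:R / N%:R); set r : R := Num.sqrt 2.
have s0 : 0 <= s by exact: sqrtr_ge0.
have r0 : 0 <= r by exact: sqrtr_ge0.
have s2 : s ^+ 2 = 2 * (V%:R / N%:R).
  by rewrite /s -mulrA sqr_sqrtr// mulr_ge0.
have r2 : r ^+ 2 = 2 by rewrite sqr_sqrtr.
have -> : 64 * V%:R * sigma ^+ 2 / (N%:R * eps) =
    64 * (V%:R / N%:R) * sigma ^+ 2 / eps.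
  by field; rewrite !lt0r_neq0.
have -> : 32 * V%:R / N%:R = 32 * (V%:R / N%:R) :> R by rewrite [RHS]mulrA.
set n := V%:R / N%:R in v0 s2 *.
set L := l + l'; have L0 : 0 <= L by rewrite addr_ge0.
set x := 8 * chi ^+ 2 * s * L; set y : R := 2 * r * eps * L.
set z := 64 * n * sigma ^+ 2 / eps.
have x0 : 0 <= x by rewrite mulr_ge0// mulr_ge0// mulr_ge0// sqr_ge0.
have y0 : 0 <= y by rewrite mulr_ge0// mulr_ge0// ?(ltW e0)// mulr_ge0.
have z0 : 0 <= z by rewrite divr_ge0// ?(ltW e0)// mulr_ge0// ?sqr_ge0// mulr_ge0.
have -> : (8 * chi ^+ 2 * s + 2 * r * eps) * L + z = x + y + z.
  by rewrite /x /y; lra.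
apply: ler_sqrt_sqr; first by rewrite !addr_ge0.
have xE : x ^+ 2 = 128 * n * chi ^+ 4 * L ^+ 2.
  by transitivity (64 * chi ^+ 4 * s ^+ 2 * L ^+ 2); [rewrite /x|rewrite s2]; ring.
have yz : y * z = 128 * r * n * sigma ^+ 2 * L.
  by rewrite /y /z; field; rewrite lt0r_neq0.
have r1 : 1 <= r by rewrite -(ler_pXn2r (n := 2))// ?nnegrE// r2 expr1n; lra.
have k1 : 32 * n * (4 * chi ^+ 4 * (l ^+ 2 + l' ^+ 2)) <= x ^+ 2.
  rewrite xE.
  have -> : 32 * n * (4 * chi ^+ 4 * (l ^+ 2 + l' ^+ 2)) =
    128 * n * chi ^+ 4 * (l ^+ 2 + l' ^+ 2) by lra.
  apply: ler_wpM2l; first by rewrite mulr_ge0 ?exprn_even_ge0// mulr_ge0.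
  by rewrite /L !expr2; nra.
have k2 : 32 * n * (16 * sigma ^+ 2 * L) <= 4 * (y * z).
  rewrite yz.
  have -> : 4 * (128 * r * n * sigma ^+ 2 * L) =
     r * (512 * n * sigma ^+ 2 * L) by lra.
  have -> : 32 * n * (16 * sigma ^+ 2 * L) = 512 * n * sigma ^+ 2 * L by lra.
  rewrite ler_peMl//.
  exact: mulr_ge0 (mulr_ge0 (mulr_ge0 (ler0n _ _) v0) (sqr_ge0 _)) L0.
have k3 : 4 * (y * z) <= (y + z) ^+ 2.
  by have := sqr_ge0 (y - z); rewrite !expr2; lra.
have : 0 <= x * (y + z) by rewrite mulr_ge0// addr_ge0.
by move: k1 k2 k3; rewrite -/L !expr2; lra.
Qed.

(** Choosing an outlier in each contaminated block is injective, because the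
    blocks are disjoint. *)
Lemma contaminated_blocks (V N : nat) (T : 'I_V -> {set 'I_N})
    (Out : {set 'I_N}) :
  (forall v v', v != v' -> (T v :&: T v')%SET = finset.set0) ->
  (#|[set v | (T v :&: Out)%SET != finset.set0]%SET| <= #|Out|)%N.
Proof.
move=> Tdisj; set K := [set v | _]%SET.
case: N T Out Tdisj @K => [|n] T Out Tdisj K.
  suff -> : K = finset.set0 by rewrite cards0.
  by apply/finset.setP => v; rewrite !inE; apply/negbTE; rewrite negbK;
    apply/eqP/finset.setP => -[].
pose f v := odflt ord0 [pick i in (T v :&: Out)%SET].
have fP v : v \in K -> (f v \in T v) && (f v \in Out).
  rewrite inE => /finset.set0Pn[i iTO]; rewrite /f; case: pickP => [j|/(_ i)].
    by rewrite inE.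
  by rewrite iTO.
have finj : {in K &, injective f}.
  move=> v w /fP/andP[vT _] /fP/andP[wT _] fvw.
  apply/eqP/negPn/negP => /Tdisj/finset.setP/(_ (f v)).
  by rewrite !inE vT fvw wT.
rewrite -(card_in_imset finj); apply/subset_leq_card/fintype.subsetP => i.
by move=> /imsetP[v /fP/andP[_ ?] ->].
Qed.

(** * Measurability with respect to the training and test data *)

Lemma measurable_lt_set (R : realType) (d : measure_display)
    (T : measurableType d) (f g : T -> R) :
  measurable_fun setT f -> measurable_fun setT g ->
  measurable [set x | (f x < g x)%R].
Proof.
move=> mf mg; have := measurable_fun_ltr mf mg.
move=> /(_ measurableT [set true] I); rewrite setTI.
by congr measurable; apply/seteqP; split=> x /=.
Qed.

(** The count reaches [k] exactly when all the events indexed by some subset of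
    [K] with at least [k] elements occur. *)
Lemma measurable_count (d : measure_display) (T : measurableType d)
    (I : finType) (A : I -> set T) (K : {set I}) (k : nat) :
  (forall v, v \in K -> measurable (A v)) ->
  measurable [set w | (k <= #|[set v in K | w \in A v]%SET|)%N].
Proof.
move=> mA.
have -> : [set w | (k <= #|[set v in K | w \in A v]%SET|)%N] =
    \bigcup_(J in [set J : {set I} | (J \subset K) && (k <= #|J|)%N])
      \bigcap_(v in [set` J]) A v.
  apply/seteqP; split=> [w kw|w [J /= /andP[JK kJ] wJ]].
    exists [set v in K | w \in A v]%SET => /=.
      by rewrite kw andbT; apply/fintype.subsetP => v; rewrite inE => /andP[].
    by move=> v /=; rewrite inE => /andP[_ /set_mem].
  apply: (leq_trans kJ); apply/subset_leq_card/fintype.subsetP => v vJ.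
  by rewrite inE (fintype.subsetP JK)//= inE; exact: wJ.
apply: fin_bigcup_measurable => [|J /= /andP[JK _]].
  exact: finite_finset.
apply: fin_bigcap_measurable => [|v /= vJ]; first exact: finite_finset.
exact/mA/(fintype.subsetP JK).
Qed.

Lemma measurable_sum_in (R : realType) (d : measure_display)
    (T : measurableType d) (I : finType) (A : {set I}) (h : I -> T -> R) :
  (forall i, i \in A -> measurable_fun setT (h i)) ->
  measurable_fun setT (fun x => \sum_(i in A) h i x).
Proof.
move=> mh; have -> : (fun x => \sum_(i in A) h i x) =
    fun x => \sum_(i <- index_enum I) (if i \in A then h i x else 0).
  by apply/funext => x; rewrite big_mkcond.
apply: measurable_sum => i; case: (boolP (i \in A)) => iA; first exact: mh.
exact: measurable_cst.
Qed.

(** Below, [OmegaS S] is the sample space carrying only the sigma-algebra of the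
    data indexed by [S].  The trained estimator is measurable for the training
    sigma-algebra jointly with the evaluation point, hence so is its excess
    risk, an integral in the second variable. *)
Section training_measurability.
Context (R : realType) (d : measure_display) (X : measurableType d)
  (P : probability (X * R)%type R) (F : set (X -> R)) (fstar : X -> R)
  (dO : measure_display) (Omega : measurableType dO)
  (N : nat) (D : 'I_N -> Omega -> X * R).

Local Notation OmegaS S := (g_sigma_algebraType (coordinate_events D S)).

Lemma measurable_coordinate (S : {set 'I_N}) i : i \in S ->
  measurable_fun setT (fun w : OmegaS S => D i w).
Proof.
by move=> iS _ A mA; rewrite setTI; apply: sub_sigma_algebra; exists i, A.
Qed.

Context (G : forall n, n.-tuple (X * R) -> X -> R).
Hypothesis hG : learning_algorithm F G.
Variables S B : {set 'I_N}.
Hypotheses (BS : B \subset S) (B0 : B != finset.set0).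

Lemma estimator_in w : F (estimator D B G w).
Proof. by have := hG (n := #|B|); rewrite card_gt0 => /(_ B0)[h _]; exact: h. Qed.

Lemma measurable_estimator :
  measurable_fun setT (fun wx : OmegaS S * X => estimator D B G wx.1 wx.2).
Proof.
have := hG (n := #|B|); rewrite card_gt0 => /(_ B0)[_ mG].
have msub : measurable_fun setT (fun w : OmegaS S => subdata D B w).
  apply/measurable_fun_tnthP => i.
  have -> : (tnth (T := (X * R)%type))^~ i \o (fun w : OmegaS S => subdata D B w) =
      fun w => D (tnth (enum_tuple B) i) w.
    by apply/funext => w /=; rewrite tnth_map.
  apply: measurable_coordinate; apply: (fintype.subsetP BS).
  by rewrite -mem_enum mem_tnth.
have mp : measurable_fun setT (fun wx : OmegaS S * X => (subdata D B wx.1, wx.2)).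
  apply: measurable_fun_pair => //.
  exact: (measurableT_comp msub).
exact: (measurableT_comp mG mp).
Qed.

Lemma measurable_excess_risk :
  measurable_fun setT
    (fun w : OmegaS S => excess_risk P fstar (estimator D B G w)).
Proof.
apply: measurable_funB => //.
apply: measurableT_comp; first exact: fine_measurable.
pose f (wz : OmegaS S * (X * R)) : \bar R := (loss (estimator D B G wz.1) wz.2)%:E.
have mf : measurable_fun setT f.
  apply/measurable_EFinP; apply: measurable_funX; apply: measurable_funB.
    by apply: measurableT_comp.
  have mp : measurable_fun setT
      (fun wz : OmegaS S * (X * R) => (wz.1, wz.2.1) : OmegaS S * X).
    by apply: measurable_fun_pair => //; exact: measurableT_comp.
  exact: (measurableT_comp measurable_estimator mp).
have f0 z : (0 <= f z)%E by rewrite lee_fin sqr_ge0.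
have := @measurable_fun_fubini_tonelli_F _ _ (OmegaS S) (X * R)%type R P f mf f0.
by rewrite /fubini_F /risk unlock.
Qed.

Lemma measurable_loss_coordinate (S' : {set 'I_N}) i : i \in S' ->
  measurable_fun setT (fun z : OmegaS S * OmegaS S' =>
    loss (estimator D B G z.1) (D i z.2)).
Proof.
move=> iS'.
have mDi : measurable_fun setT (fun z : OmegaS S * OmegaS S' => D i z.2).
  exact: (measurableT_comp (measurable_coordinate iS')).
apply: measurable_funX; apply: measurable_funB.
  exact: (measurableT_comp measurable_snd mDi).
have mp : measurable_fun setT
    (fun z : OmegaS S * OmegaS S' => (z.1, (D i z.2).1) : OmegaS S * X).
  apply: measurable_fun_pair => //.
  exact: (measurableT_comp measurable_fst mDi).
exact: (measurableT_comp measurable_estimator mp).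
Qed.

End training_measurability.

(** * The test comparing two estimators *)

Section pair_event.
Context (R : realType) (d : measure_display) (X : measurableType d)
  (P : probability (X * R)%type R) (F : set (X -> R)) (fstar : X -> R).
Hypothesis hY : ('E_P[fun z : X * R => (z.2 ^+ 2)%R] < +oo)%E.
Hypothesis hF : L2_subspace P F.
Hypothesis hfstar : is_oracle P F fstar.
Context (dO : measure_display) (Omega : measurableType dO)
  (Pr : probability Omega R) (N : nat) (D : 'I_N -> Omega -> X * R).
Hypothesis hN : (1 <= N)%N.
Hypothesis hD : forall i, measurable_fun setT (D i).
Variable Out : {set 'I_N}.
Hypothesis hI : iid_with_law Pr D P (~: Out).
Variables (chi sigma : R).
Hypothesis hchi : 0 < chi.
Hypothesis hL4 : forall f, F f ->
  ('E_P[fun z : X * R => (f z.1 ^+ 4)%R] `^ (4^-1)%R <=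
   chi%:E * 'E_P[fun z : X * R => (f z.1 ^+ 2)%R] `^ (2^-1)%R)%E.
Hypothesis hL2 : forall f, F f ->
  ('E_P[fun z : X * R =>
      ((z.2 - fstar z.1) ^+ 2 * (f z.1 - fstar z.1) ^+ 2)%R] <=
   (sigma ^+ 2)%:E * 'E_P[fun z : X * R => ((f z.1 - fstar z.1) ^+ 2)%R])%E.
Context (G1 G2 : forall n, n.-tuple (X * R) -> X -> R).
Hypotheses (hG1 : learning_algorithm F G1) (hG2 : learning_algorithm F G2).
Variables (B1 B2 : {set 'I_N}).
Hypotheses (hB1 : B1 != finset.set0) (hB2 : B2 != finset.set0).
Variable (V : nat).
Hypotheses (hV1 : (1 <= V)%N) (hVO : (3 * #|Out| <= V)%N).
Variable T : 'I_V -> {set 'I_N}.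
Hypothesis hT : test_blocks R (B1 :|: B2) T.
Hypothesis hindep : independent_families Pr D (B1 :|: B2)
  ((\bigcup_(v : 'I_V) T v)%SET :\: Out).

Local Notation S1 := (B1 :|: B2)%SET.
Local Notation S2 := ((\bigcup_(v : 'I_V) T v)%SET :\: Out)%SET.
Local Notation OmegaS S := (g_sigma_algebraType (coordinate_events D S)).

Let f1 w := estimator D B1 G1 w.
Let f2 w := estimator D B2 G2 w.
Let l1 w := excess_risk P fstar (f1 w).
Let l2 w := excess_risk P fstar (f2 w).

(** For [p = 1/8] and blocks of size [N / (4 V)], Chebyshev's inequality asks for
    [t^2 = 8 * (4 V / N) * E h^2]. *)
Definition mom_threshold (w : Omega) : R :=
  Num.sqrt (32 * V%:R / N%:R * moment_bound chi sigma (l1 w) (l2 w)).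

(** The estimators are trained at the sample point [w], the block is observed at
    [w']; the two are separated so that one can be frozen. *)
Definition bad_block (v : 'I_V) (w w' : Omega) : Prop :=
  mom_threshold w <
  `|empirical_mean D (T v) (fun z => loss (f1 w) z - loss (f2 w) z) w' -
    (l1 w - l2 w)|.

Definition clean_blocks : {set 'I_V} :=
  [set v | (T v :&: Out)%SET == finset.set0]%SET.

(** The least number of deviating clean blocks that, together with all the
    contaminated ones, makes up half of the blocks. *)
Definition bad_count : nat := uphalf V - (V - #|clean_blocks|).

Definition bad_at (v : 'I_V) : set Omega := [set w | bad_block v w w].

Definition bad_event : set Omega :=
  [set w | (bad_count <= #|[set v in clean_blocks | w \in bad_at v]%SET|)%N].

Let clean_sub v : v \in clean_blocks -> T v \subset ~: Out.
Proof.
by rewrite inE finset.setI_eq0 finset.disjoints_subset.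
Qed.

Let clean_sub2 v : v \in clean_blocks -> T v \subset S2.
Proof.
move=> vK; apply/fintype.subsetP => i iT.
rewrite finset.in_setD -finset.in_setC (fintype.subsetP (clean_sub vK))//=.
by apply/finset.bigcupP; exists v.
Qed.

Let clean_card : (#|clean_blocks| <= V)%N.
Proof. by rewrite -[leqRHS]card_ord max_card. Qed.

Let clean_many : (3 * (V - #|clean_blocks|) <= V)%N.
Proof.
apply: leq_trans hVO; rewrite leq_mul2l/=.
have [_ Tdisj _] := hT.
apply: leq_trans (contaminated_blocks Out Tdisj).
rewrite leq_subLR.
have <- : (~: clean_blocks)%SET =
    [set v | (T v :&: Out)%SET != finset.set0]%SET.
  by apply/finset.setP => v; rewrite !inE.
by rewrite cardsC card_ord.
Qed.

Let C_ v : set (OmegaS S1 * OmegaS S2) := [set z | bad_block v z.1 z.2].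

Let measurable_C v : v \in clean_blocks -> measurable (C_ v).
Proof.
move=> vK.
have ml1 : measurable_fun setT (fun w : OmegaS S1 => l1 w).
  by apply: (measurable_excess_risk P fstar hG1) => //; exact: finset.subsetUl.
have ml2 : measurable_fun setT (fun w : OmegaS S1 => l2 w).
  by apply: (measurable_excess_risk P fstar hG2) => //; exact: finset.subsetUr.
apply: measurable_lt_set.
  apply: (measurableT_comp (f := fun w : OmegaS S1 => mom_threshold w)) => //.
  rewrite /mom_threshold; apply: measurableT_comp.
    by apply: continuous_measurable_fun; exact: sqrt_continuous.
  apply: measurable_funM => //; rewrite /moment_bound.
  apply: measurable_funD; apply: measurable_funM => //.
  - by apply: measurable_funD; apply: measurable_funX.
  - by apply: measurable_funD.
have mfst (l : OmegaS S1 -> R) : measurable_fun setT l ->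
    measurable_fun setT (fun z : OmegaS S1 * OmegaS S2 => l z.1).
  by move=> ml; exact: (measurableT_comp ml).
apply: measurableT_comp => //; apply: measurable_funB; last first.
  by apply: measurable_funB; [exact: (mfst l1)|exact: (mfst l2)].
apply: measurable_funM => //.
apply: measurable_sum_in => i iT.
have iS2 := fintype.subsetP (clean_sub2 vK) _ iT.
apply: measurable_funB.
- exact: (measurable_loss_coordinate hG1 (finset.subsetUl _ _) hB1).
- exact: (measurable_loss_coordinate hG2 (finset.subsetUr _ _) hB2).
Qed.

Let measurable_id S : measurable_fun setT (fun w : Omega => w : OmegaS S).
Proof.
by move=> _ A mA; rewrite setTI; exact: (sigma_of_measurable hD (S := S) mA).
Qed.

Let U1 : {mfun Omega >-> OmegaS S1} := mfun_Sub (mem_set (measurable_id (S := S1))).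
Let U2 : {mfun Omega >-> OmegaS S2} := mfun_Sub (mem_set (measurable_id (S := S2))).

Let Cbad : set (OmegaS S1 * OmegaS S2) :=
  [set z | (bad_count <= #|[set v in clean_blocks | z \in C_ v]%SET|)%N].

Let measurable_Cbad : measurable Cbad.
Proof. exact: measurable_count. Qed.

Let bad_eventE : bad_event = [set w | Cbad (U1 w, U2 w)].
Proof.
apply/seteqP; split=> w; rewrite /bad_event /Cbad /=;
  by under eq_finset do rewrite !(inE, in_setE).
Qed.

Lemma bad_event_measurable : measurable bad_event.
Proof.
rewrite bad_eventE -[X in measurable X]setTI.
have mU : measurable_fun setT (fun w => (U1 w, U2 w)).
  exact: measurable_fun_pair.
exact: mU.
Qed.

(** For fixed training data the increment is a fixed function with bounded second
    moment, to which the deviation bound of an i.i.d. block applies. *)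
Let fixed_block w v : v \in clean_blocks ->
  (Pr [set w' | bad_block v w w'] <= (8^-1)%:E)%E.
Proof.
move=> vK; have [_ _ Tcard] := hT.
have F1 : F (f1 w) by exact: (estimator_in D hG1 hB1).
have F2 : F (f2 w) by exact: (estimator_in D hG2 hB2).
rewrite /bad_block /empirical_mean -(expectation_loss_diff fstar hY hF F1 F2).
have N0 : 0 < N%:R :> R by rewrite ltr0n.
have V0 : 0 < V%:R :> R by rewrite ltr0n.
have T0 : 0 < #|T v|%:R :> R.
  by apply: lt_le_trans (Tcard v); rewrite divr_gt0// mulr_gt0.
have Q0 : 0 <= moment_bound chi sigma (l1 w) (l2 w).
  by apply: moment_bound_ge0; apply: (excess_risk_ge0 hY hF hfstar).
apply: (block_mean_deviation hD hI (clean_sub vK)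
  (h := fun z => loss (f1 w) z - loss (f2 w) z)
  (Q := moment_bound chi sigma (l1 w) (l2 w))).
- by rewrite -(ltr0n R).
- by apply: measurable_funB; apply: (loss_measurable hY hF).
- exact: (loss_diff_second_moment hY hF hfstar hchi hL4 hL2 F1 F2).
- exact: sqrtr_ge0.
- rewrite sqr_sqrtr; last by rewrite mulr_ge0// divr_ge0// mulr_ge0// ltW.
  rewrite mulrA ler_wpM2r//.
  have := Tcard v; rewrite ler_pdivrMr ?mulr_gt0// => h.
  by rewrite mulrA ler_pdivlMr//; lra.
Qed.

Let fixed_block_sigma w v : v \in clean_blocks ->
  sigma_of D (T v) [set w' | bad_block v w w'].
Proof.
move=> vK.
have F1 : F (f1 w) by exact: (estimator_in D hG1 hB1).
have F2 : F (f2 w) by exact: (estimator_in D hG2 hB2).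
suff : measurable ([set w' | bad_block v w w'] : set (OmegaS (T v))) by [].
apply: measurable_lt_set; first exact: measurable_cst.
apply: measurableT_comp => //; apply: measurable_funB => //.
apply: measurable_funM => //.
apply: measurable_sum_in => i iT.
apply: (measurableT_comp (f := fun z => loss (f1 w) z - loss (f2 w) z)).
  by apply: measurable_funB; apply: (loss_measurable hY hF).
exact: measurable_coordinate.
Qed.

(** By decoupling it suffices to bound the probability for frozen training data,
    where the deviations of the clean blocks are independent events of
    probability at most [1/8]. *)
Lemma bad_event_prob : (Pr bad_event <= (expR (- (V%:R / 48)))%:E)%E.
Proof.
rewrite bad_eventE; apply: decoupling => //.
move=> w.
pose A v := [set w' | bad_block v w w'].
have -> : [set w' | Cbad (U1 w, U2 w')] =
    [set w' | (bad_count <= #|[set v in clean_blocks | w' \in A v]%SET|)%N].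
  apply/seteqP; split=> w'; rewrite /Cbad /=;
    by under eq_finset do rewrite !(inE, in_setE).
have mA v : v \in clean_blocks -> measurable (A v).
  by move=> vK; exact: (sigma_of_measurable hD (fixed_block_sigma w vK)).
apply: (@le_trans _ _ (expR (- (2^-1 * bad_count%:R)) *
    (1 + (expR 2^-1 - 1) * 8^-1) ^+ #|clean_blocks|)%:E).
  apply: chernoff_count => //.
  - move=> J JK; apply: (independent_blocks hD (T := T) hI.2).
    + by move=> v vJ; apply/clean_sub/(fintype.subsetP JK).
    + by have [_ Tdisj _] := hT.
    + by move=> v vJ; apply: fixed_block_sigma; exact: (fintype.subsetP JK).
  - by move=> v vK; exact: fixed_block.
  - exact: measurable_count.
rewrite lee_fin; apply: chernoff_majority => //.
by rewrite mul2n -leq_uphalf_double -leq_subLR.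
Qed.

(** Outside the bad event, even if every contaminated block deviates, fewer than
    half of all blocks do. *)
Lemma good_event_close w (x : R) : ~ bad_event w ->
  is_median (fun v : 'I_V => empirical_mean D (T v)
    (fun z => loss (f1 w) z - loss (f2 w) z) w) x ->
  `|x - (l1 w - l2 w)| <= mom_threshold w.
Proof.
move=> good med; apply: (median_close med).
rewrite ltnNge mul2n -leq_uphalf_double; apply/negP => many; apply: good.
rewrite /bad_event /= leq_subLR; apply: (leq_trans many).
have -> : (V - #|clean_blocks|)%N = #|~: clean_blocks|.
  have cK := finset.cardsC clean_blocks; rewrite card_ord in cK.
  by rewrite -[X in (X - _)%N]cK addKn.
apply: leq_trans (finset.leq_card_setU _ _).1; apply/subset_leq_card.
apply/fintype.subsetP => v; rewrite !inE => bv.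
by case: (_ == _) => //=; rewrite inE.
Qed.

End pair_event.

(** * The oracle inequality *)

Theorem theorem3p2 (R : realType)
  (d : measure_display) (X : measurableType d) (P : probability (X * R)%type R)
  (hY : ('E_P[fun z : X * R => (z.2 ^+ 2)%R] < +oo)%E)
  (F : set (X -> R)) (hF : L2_subspace P F)
  (fstar : X -> R) (hfstar : is_oracle P F fstar)
  (* dataset; the complement of [Out] indexes the informative data *)
  (dO : measure_display) (Omega : measurableType dO) (Pr : probability Omega R)
  (N : nat) (hN : (1 <= N)%N)
  (D : 'I_N -> Omega -> X * R) (hD : forall i, measurable_fun setT (D i))
  (Out : {set 'I_N}) (hI : iid_with_law Pr D P (~: Out))
  (* algorithms and training subsamples *)
  (M : finType) (G : M -> forall n, n.-tuple (X * R) -> X -> R)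
  (hG : forall m, learning_algorithm F (G m))
  (B : M -> {set 'I_N})
  (hB0 : forall m, B m != finset.set0)
  (hB : forall m, #|B m|%:R < N%:R / 4 :> R)
  (* test blocks *)
  (V : nat) (hV1 : (1 <= V)%N) (hVO : (3 * #|Out| <= V)%N)
  (hVN : V%:R <= N%:R / 8 :> R)
  (T : M -> M -> 'I_V -> {set 'I_N})
  (hT : forall m m', test_blocks R (B m :|: B m') (T m m'))
  (* outliers are arbitrary, but the training data do not carry information
     about the informative test data *)
  (hindep : forall m m', independent_families Pr D (B m :|: B m')
     ((\bigcup_(v : 'I_V) T m m' v)%SET :\: Out))
  (* median-of-means statistics and minmax selection *)
  (TT : M -> M -> Omega -> R)
  (hTT : forall m m' w,
     is_median (fun v : 'I_V => empirical_mean D (T m m' v)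
                  (fun z => loss (estimator D (B m) (G m) w) z -
                            loss (estimator D (B m') (G m') w) z) w)
               (TT m m' w))
  (mhat : Omega -> M)
  (hmhat : forall w,
     is_argmin (fun m => finmax m (fun m' => TT m m' w)) (mhat w))
  (chi sigma : R) (hchi : 0 < chi) (hsigma : 0 < sigma)
  (hL4 : forall f, F f ->
     ('E_P[fun z : X * R => (f z.1 ^+ 4)%R] `^ (4^-1)%R <=
      chi%:E * 'E_P[fun z : X * R => (f z.1 ^+ 2)%R] `^ (2^-1)%R)%E)
  (hL2 : forall f, F f ->
     ('E_P[fun z : X * R =>
         ((z.2 - fstar z.1) ^+ 2 * (f z.1 - fstar z.1) ^+ 2)%R] <=
      (sigma ^+ 2)%:E * 'E_P[fun z : X * R => ((f z.1 - fstar z.1) ^+ 2)%R])%E) :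
  exists E : set Omega,
    [/\ measurable E,
        ((1 - #|M|%:R ^+ 2 * expR (- (V%:R / 48)))%:E <= Pr E)%E &
        forall w, E w -> forall eps : R, 0 < eps ->
          (1 - a_const chi N V eps) *
            excess_risk P fstar
              (estimator D (B (mhat w)) (G (mhat w)) w) <=
          (1 + 3 * a_const chi N V eps) *
            finmin (mhat w) (fun m =>
              excess_risk P fstar (estimator D (B m) (G m) w)) +
          2 * b_const sigma N V eps].

Proof.
pose Bad (p : M * M) := bad_event P fstar D Out chi sigma
  (G p.1) (G p.2) (B p.1) (B p.2) (T p.1 p.2).
have [mBad PBad] : measurable (\bigcup_p Bad p) /\
    (Pr (\bigcup_p Bad p) <=
     (#|{: M * M}|%:R * expR (- (V%:R / 48)))%:E)%E.
  apply: union_bound => -[m m'].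
    exact: (bad_event_measurable P fstar hD Out chi sigma (hG m) (hG m')).
  exact: (bad_event_prob hY hF hfstar hN hD hI hchi hL4 hL2 (hG m) (hG m')).
exists (~` \bigcup_p Bad p); split.
- exact: measurableC.
- rewrite probability_setC// EFinB leeB//.
  by rewrite card_prod natrM -expr2 in PBad.
- move=> w good eps eps0.
  pose l m := excess_risk P fstar (estimator D (B m) (G m) w).
  have l0 m : 0 <= l m.
    by apply: (excess_risk_ge0 hY hF hfstar); exact: (estimator_in D (hG m)).
  apply: (minmax_selection (l := l) (T := fun m m' => TT m m' w)) => //.
  + have e0 := ltW eps0.
    by apply: addr_ge0; apply: mulr_ge0 => //; apply: mulr_ge0 => //; exact: sqr_ge0.
  + apply: divr_ge0; first by rewrite mulr_ge0 ?sqr_ge0// mulr_ge0.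
    by rewrite mulr_ge0// ltW.
  + move=> m m'; apply: le_trans (threshold_le _ _ _ hN (l0 m) (l0 m') eps0).
    apply: (good_event_close (Out := Out) (T := T m m')); last exact: hTT.
    by move=> bad; apply: good; exists (m, m').
Qed.
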